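(* The parameterized problem Subset Feedback Arc Set in Tournaments (Subset-FAST), parameterized by $k$, admits a kernel with $\mathcal{O}(k^2)$ vertices. That is, there is a polynomial-time algorithm that, given an instance $(T,S,k)$ of Subset-FAST, outputs an instance $(T',S',k')$ of Subset-FAST such that $(T,S,k)$ is a yes-instance if and only if $(T',S',k')$ is a yes-instance, and $|V(T')| = \mathcal{O}(k^2)$ and $k'\le k$.
   Context: A tournament is a directed graph with exactly one arc between every pair of distinct vertices. For a directed graph $D$ and $S\subseteq V(D)$, an $S$-cycle is a directed cycle containing at least one vertex of $S$. Subset-FAST: given a tournament $T$, a set $S\subseteq V(T)$ (terminals) and an integer $k$, decide whether there exists $F\subseteq A(T)$ with $|F|\le k$ such that $T-F$ (the digraph obtained by deleting the arcs of $F$) contains no $S$-cycle. A kernel is a polynomial-time algorithm mapping an instance to an equivalent instance whose size is bounded by a function of the parameter $k$ alone. *)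

(* Defs.v *)
From mathcomp Require Import all_boot.

Set Implicit Arguments.
Unset Strict Implicit.
Unset Printing Implicit Defensive.

Definition tournament (V : finType) (e : rel V) : Prop :=
  irreflexive e /\ (forall x y : V, x != y -> e x y (+) e y x).

Definition arcs (V : finType) (e : rel V) : {set V * V} :=
  [set a | e a.1 a.2].

Definition del_arcs (V : finType) (e : rel V) (F : {set V * V}) : rel V :=
  fun x y => e x y && ((x, y) \notin F).

Definition S_cycle (V : finType) (e : rel V) (S : {set V}) (c : seq V) : bool :=
  [&& cycle e c, uniq c & has (fun x => x \in S) c].

Record instance := Instance {
  nvert : nat;
  arc : rel 'I_nvert;
  arc_tournament : tournament arc;
  terminals : {set 'I_nvert};
  budget : nat
}.

Definition yes_instance (I : instance) : Prop :=
  exists F : {set 'I_(nvert I) * 'I_(nvert I)},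
    [/\ F \subset arcs (@arc I),
        #|F| <= budget I &
        forall c, ~~ S_cycle (del_arcs (@arc I) F) (terminals I) c].

(* The machine model is a random access machine with structured control,
   finitely many registers per program and an unbounded memory of naturals.
   The only arithmetic is + and truncated subtraction, and every operation
   has unit cost.  Since there is no multiplication, t steps lengthen the
   numbers involved by O(t) bits, so running times are polynomially related
   to those of Turing machines. *)

Inductive expr :=
  | Const of nat
  | Reg of nat
  | Fetch of expr
  | Add of expr & expr
  | Sub of expr & expr.

Inductive prog :=
  | Skip
  | Set_reg of nat & expr
  | Store of expr & expr
  | Seq of prog & prog
  | If of expr & prog & prog
  | While of expr & prog.

Record state := State { regs : nat -> nat; memory : nat -> nat }.

Definition update (f : nat -> nat) (i v : nat) : nat -> nat :=
  fun j => if j == i then v else f j.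

Fixpoint eval (s : state) (e : expr) : nat :=
  match e with
  | Const n => n
  | Reg r => regs s r
  | Fetch a => memory s (eval s a)
  | Add a b => eval s a + eval s b
  | Sub a b => eval s a - eval s b
  end.

Fixpoint ecost (e : expr) : nat :=
  match e with
  | Const _ | Reg _ => 1
  | Fetch a => (ecost a).+1
  | Add a b | Sub a b => (ecost a + ecost b).+1
  end.

(* exec p s t s': started in s, the program p halts in state s' after
   exactly t steps; a test succeeds when its value is nonzero. *)
Inductive exec : prog -> state -> nat -> state -> Prop :=
  | ExecSkip s : exec Skip s 1 s
  | ExecSet_reg s r e :
      exec (Set_reg r e) s (ecost e).+1
           (State (update (regs s) r (eval s e)) (memory s))
  | ExecStore s a e :
      exec (Store a e) s (ecost a + ecost e).+1
           (State (regs s) (update (memory s) (eval s a) (eval s e)))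
  | ExecSeq s s1 s2 t1 t2 p q :
      exec p s t1 s1 -> exec q s1 t2 s2 -> exec (Seq p q) s (t1 + t2).+1 s2
  | ExecIfT s s' t e p q :
      eval s e != 0 -> exec p s t s' -> exec (If e p q) s (ecost e + t).+1 s'
  | ExecIfF s s' t e p q :
      eval s e = 0 -> exec q s t s' -> exec (If e p q) s (ecost e + t).+1 s'
  | ExecWhileT s s1 s2 t1 t2 e p :
      eval s e != 0 -> exec p s t1 s1 -> exec (While e p) s1 t2 s2 ->
      exec (While e p) s (ecost e + t1 + t2).+1 s2
  | ExecWhileF s e p :
      eval s e = 0 -> exec (While e p) s (ecost e).+1 s.

(* Number of vertices, budget, indicator of the terminals, and the adjacency
   matrix row by row. *)
Definition encode (I : instance) : seq nat :=
  [:: nvert I, budget I &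
      [seq nat_of_bool (x \in terminals I) | x <- enum 'I_(nvert I)]
      ++ [seq nat_of_bool (arc x y) | x <- enum 'I_(nvert I),
                                      y <- enum 'I_(nvert I)]].

(* Total bit length of the encoding; in particular the budget is written in
   binary. *)
Definition input_size (I : instance) : nat :=
  \sum_(x <- encode I) (trunc_log 2 x).+1.

Definition init_state (w : seq nat) : state :=
  State (fun=> 0) (fun i => nth 0 w i).

Definition holds_output (s : state) (w : seq nat) : Prop :=
  forall i, i < size w -> memory s i = nth 0 w i.

Definition poly_time (f : instance -> instance) : Prop :=
  exists (p : prog) (c d : nat), forall I : instance,
    exists (t : nat) (s : state),
      [/\ exec p (init_state (encode I)) t s,
          t <= c * input_size I ^ d &
          holds_output s (encode (f I))].

(* Main.v *)
Require Import Defs.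
From mathcomp Require Import all_boot zify.
From Stdlib Require Import IndefiniteDescription.

(** Deleting a minimal set of arcs amounts to arranging the vertices in levels
    with each terminal alone on its level: the deleted arcs are the ones going
    down.  Two rules delete one vertex at a time.

    Class rule: let [M] consist of the non-terminals with one and the same
    relation to every terminal, and let the core of [M] be its vertices with
    more than [k] in- and out-neighbours in [M].  In a solution of cost at most
    [k] the whole core lies between the same terminals, so only the numbers of
    arcs between it and each other vertex matter, and only up to [k + 1].  A
    core of more than [3 k + 3] vertices is thus replaced by one with a vertex
    less.  A class has at most [4 k + 2] vertices outside its core.

    Module rule: if the interval between two terminals is a module without
    S-triangle and has more than [8 k + 6] vertices, then in every solution of
    cost at most [k] it can be placed cleanly between its in- and
    out-neighbours, so that its first terminal is redundant.

    When no rule applies to a solvable instance, let [P] be the at most [2 k]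
    ends of the arcs going down.  The remaining vertices are linearly arranged
    around their terminals.  [P] meets O(k) of the gaps, which contain O(k)
    classes of size O(k); the rest splits into O(k) intervals to which the
    module rule would apply if they had more than [8 k + 6] vertices.

    For the running time, the rules are written in a language of expressions
    with bounded sums over the memory, which is compiled to the machine with
    every loop of length at most [N + 1]. *)

Set Implicit Arguments.
Unset Strict Implicit.
Unset Printing Implicit Defensive.

(** The converse of the class rule is what fixes its constant: the smaller core must again be forced
    into one slot, so it needs all in- and outdegrees above [k]. Three cyclically dominating blocks
    of [k + 1] vertices achieve this, whence [3 k + 3]. A class then has at most [7 k + 5] vertices,
    and [8 k + 6 = (7 k + 5) + (k + 1)] leaves the module rule more than [k] vertices that pay. The
    module rule thus relies on the class bound and is tried only when the class rule no longer
    applies. The obstacle to a quadratic bound is the number of classes near [P]: counting touched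
    gaps times types per gap gives a cubic bound. Instead two quantities that grow along arcs, one
    for the gaps and one for the terminals in [P], are added, and their sum alone determines the
    type. On the machine, the budget is a binary number and there is no multiplication, so no loop
    may run [k] times. Everything is phrased by cardinalities over the vertices, including ranks and
    the choice of the vertex to which a rule is applied. *)

Local Ltac goal_lia := clear; lia.

(** * Levels and the two exchange arguments *)

Section Levels.
Variables (V : finType) (S : {set V}).
Implicit Types (A X W Z : {set V}) (e : rel V) (h : V -> nat) (k : nat).

(** Relative to [A] because the rules shrink the vertex set inside one fixed type; the layout of the
    memory then never changes. *)
Definition tournament_on A e : Prop :=
  (forall x, x \in A -> ~~ e x x) /\
  (forall x y, x \in A -> y \in A -> x != y -> e x y = ~~ e y x).

Definition separated A h : Prop :=
  forall s x, s \in S -> s \in A -> x \in A -> x != s -> h x != h s.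

Definition back_arcs A e h : {set V * V} :=
  [set p | [&& p.1 \in A, p.2 \in A, e p.1 p.2 & h p.2 < h p.1]].

Definition solvable A e k : Prop :=
  exists2 h, separated A h & #|back_arcs A e h| <= k.

(** Arcs out of terminals suffice: for non-terminals of a tournament they determine the arcs into
    terminals. *)
Definition same_type A e (x y : V) : bool :=
  [forall s in S :&: A, e s x == e s y].

(** The charging principle of both exchange arguments: [g] recovers from an arc the vertex that it
    pays for, so distinct vertices are paid by distinct arcs. *)
Lemma card_le_preimage (T1 T2 : finType) (B : {set T1}) (Y : {set T2})
    (g : T1 -> T2) :
  (forall y, y \in Y -> exists2 p, p \in B & g p = y) -> #|Y| <= #|B|.
Proof.
move=> H; apply: leq_trans (leq_imset_card g B); apply: subset_leq_card.
by apply/subsetP=> y /H [p pB <-]; apply: imset_f.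
Qed.

Lemma tournament_onS A A' e :
  A' \subset A -> tournament_on A e -> tournament_on A' e.
Proof.
move=> /subsetP sub [irr tot]; split=> [x /sub|x y /sub xA /sub]; first exact: irr.
exact: tot.
Qed.

Lemma solvableS A A' e k : A' \subset A -> solvable A e k -> solvable A' e k.
Proof.
move=> /subsetP sub [h sep le_k]; exists h.
  by move=> s x sS /sub sA /sub xA; apply: sep.
apply: leq_trans le_k; apply: subset_leq_card; apply/subsetP=> p; rewrite !inE.
by case/and4P=> /sub -> /sub -> -> ->.
Qed.

Lemma card_back_arcs A e h :
  #|back_arcs A e h| = \sum_(x in A) \sum_(y in A) (e x y && (h y < h x)).
Proof.
rewrite -sum1_card big_mkcond /= pair_big_dep /= [RHS]big_mkcond /=.
by apply: eq_bigr => p _; rewrite !inE; do 2!case: (_ \in A) => //=; case: ifP.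
Qed.

(** Isolates the mixed arcs and groups them by their end in [W], so that an exchange of [Z] can be
    compared vertex by vertex. *)
Lemma card_back_arcsU W Z e h : [disjoint W & Z] ->
  #|back_arcs (W :|: Z) e h| = #|back_arcs W e h| + #|back_arcs Z e h| +
    \sum_(x in W) (#|[set z in Z | e z x && (h x < h z)]| +
                   #|[set z in Z | e x z && (h z < h x)]|).
Proof.
move=> dWZ; rewrite !card_back_arcs big_split /=.
have E (b : V -> V -> bool) : \sum_(x in W) #|[set z in Z | b z x]| =
    \sum_(x in W) \sum_(z in Z) b z x.
  apply: eq_bigr => x _; rewrite -sum1_card big_mkcond [RHS]big_mkcond /=.
  by apply: eq_bigr => z _; rewrite inE; case: (z \in Z) => //=; case: (b z x).
rewrite (E (fun z x => e z x && (h x < h z))) (E (fun z x => e x z && (h z < h x))).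
rewrite [X in _ = _ + (X + _)]exchange_big /=.
have HU (F : V -> nat) :
    \sum_(x in W :|: Z) F x = \sum_(x in W) F x + \sum_(x in Z) F x.
  by rewrite -bigU //; apply: eq_bigl => x; rewrite !inE.
rewrite HU.
under eq_bigr => x _ do rewrite HU.
under [X in _ + X = _]eq_bigr => x _ do rewrite HU.
by rewrite !big_split /=; lia.
Qed.

(* A vertex of [M] outside the slot between the terminals of [tau] and the
   other ones pays for a back arc to a terminal; a vertex of [Z1] outside the
   slot pays in addition for its arcs to the slot, which the degree hypothesis
   makes too expensive.  Once [Z1] lies in the slot, only the numbers of arcs
   between it and the other vertices matter. *)
Lemma solvable_exchange W (Z1 Z2 M : {set V}) (e1 e2 : rel V) k (tau : pred V) z1 :
  [disjoint W & Z1] -> [disjoint W & Z2] ->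
  tournament_on (W :|: Z1) e1 ->
  (forall z, z \in Z1 -> z \notin S) -> (forall z, z \in Z2 -> z \notin S) ->
  {in W &, e1 =2 e2} ->
  z1 \in Z1 -> Z1 \subset M -> M \subset W :|: Z1 ->
  (forall y, y \in M -> y \notin S) ->
  (forall y s, y \in M -> s \in S -> s \in W -> e1 s y = tau s) ->
  (forall z, z \in Z1 -> k < #|[set y in M | e1 y z]|) ->
  (forall z, z \in Z1 -> k < #|[set y in M | e1 z y]|) ->
  (forall x, x \in W -> minn k.+1 #|[set z in Z1 | e1 z x]| =
                        minn k.+1 #|[set z in Z2 | e2 z x]|) ->
  (forall x, x \in W -> minn k.+1 #|[set z in Z1 | e1 x z]| =
                        minn k.+1 #|[set z in Z2 | e2 x z]|) ->
  solvable (W :|: Z1) e1 k -> solvable (W :|: Z2) e2 k.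
Proof.
move=> dW1 dW2 [irr tot] Z1S Z2S eqe z1Z /subsetP ZM /subsetP MA MS Mtau.
move=> degin degout outeq ineq [h sep le_k].
set A := W :|: Z1 in irr tot MA sep le_k *.
have WA x : x \in W -> x \in A by rewrite inE => ->.
have ZA x : x \in Z1 -> x \in A by rewrite inE orbC => ->.
have SW s : s \in S -> s \in A -> s \in W.
  by move=> sS; rewrite inE; case/orP => // /Z1S; rewrite sS.
have EA : A = W :|: Z1 by [].
clearbody A; set B := back_arcs A e1 h in le_k *.
(* The slot is defined by the level alone, so a whole level is in or out; a terminal is never
   inside, as it would have to be strictly above or below itself. *)
pose inD y := [forall s in S :&: W, if tau s then h s < h y else h y < h s].
have inDP y s : inD y -> s \in S -> s \in W ->
    if tau s then h s < h y else h y < h s.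
  by move=> /forall_inP H sS sW; apply: H; rewrite inE sS.
have notD y : ~~ inD y -> y \in A -> y \notin S -> exists2 s,
    (s \in S) && (s \in W) & if tau s then h y < h s else h s < h y.
  rewrite negb_forall_in => /exists_inP [s]; rewrite inE => /andP[sS sW] H yA yS.
  exists s; first by rewrite sS.
  have : h y != h s by apply: sep => //; [exact: WA | apply: contraNneq yS => ->].
  by move: H; case: ifP => _; goal_lia.
have chg y : y \in M -> ~~ inD y -> exists2 s, (s \in S) && (s \in W) &
    ((s, y) \in B) || ((y, s) \in B).
  move=> yM yD; case: (notD y) => // [||s /andP[sS sW] H]; [exact: MA|exact: MS|].
  exists s; first by rewrite sS.
  have yA := MA _ yM; have sA := WA _ sW.
  have ny : y != s by apply: contraNneq (MS _ yM) => ->.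
  rewrite !inE /= yA sA (tot y s) // (Mtau y s) //.
  by move: H; case: (tau s) => /= ->; rewrite ?orbT.
have ZD z : z \in Z1 -> inD z.
  move=> zZ; apply/negPn/negP => zD.
  have zM := ZM _ zZ; have zA := MA _ zM.
  case: (notD z) => // [|s /andP[sS sW] H]; first exact: MS.
  (* An arc leaving a terminal or [z] pays for its head, any other one for its tail. If [z] is below
     a terminal that it should be above, each in-neighbour in [M] either pays with a terminal or
     lies in the slot, hence above [z]; in the other case the out-neighbours pay. *)
  pose g (p : V * V) := if (p.1 \in S) || (p.1 == z) then p.2 else p.1.
  have sg y s' : y \in M -> y != z -> s' \in S -> ((s', y) \in B) || ((y, s') \in B) ->
      exists2 p, p \in B & g p = y.
    move=> yM yz s'S; case/orP => pB; [exists (s', y)|exists (y, s')] => //.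
      by rewrite /g /= s'S.
    by rewrite /g /= (negPf (MS _ yM)) (negPf yz).
  move: H; case: ifP => ts H.
    have := degin z zZ; apply/negP; rewrite -leqNgt; apply: leq_trans le_k.
    apply: (@card_le_preimage _ _ _ _ g) => y; rewrite inE => /andP[yM eyz].
    have yz : y != z by apply: contraTneq eyz => ->; apply: irr.
    case yD: (inD y); last first.
      by case: (chg y yM (negbT yD)) => s' /andP[s'S _]; apply: sg.
    exists (y, z); last by rewrite /g /= (negPf (MS _ yM)) (negPf yz).
    rewrite inE /= (MA _ yM) zA eyz /=.
    by move: H (inDP _ _ yD sS sW); rewrite ts; goal_lia.
  have := degout z zZ; apply/negP; rewrite -leqNgt; apply: leq_trans le_k.
  apply: (@card_le_preimage _ _ _ _ g) => y; rewrite inE => /andP[yM eyz].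
  have yz : y != z by apply: contraTneq eyz => ->; apply: irr.
  case yD: (inD y); last first.
    by case: (chg y yM (negbT yD)) => s' /andP[s'S _]; apply: sg.
  exists (z, y); last by rewrite /g /= eqxx orbT.
  rewrite inE /= (MA _ yM) zA eyz /=.
  by move: H (inDP _ _ yD sS sW); rewrite ts; goal_lia.
pose d := h z1.
have dD := ZD _ z1Z.
have lowD x : x \in W -> ~~ inD x || (x \in S) -> h x < d ->
    forall y, inD y -> h x < h y.
  move=> xW xD xd y yD.
  case xS: (x \in S).
    move: xd (inDP _ _ yD xS xW) (inDP _ _ dD xS xW); rewrite -/d.
    by case: ifP => _; goal_lia.
  rewrite xS orbF in xD.
  case: (notD x) => // [||s /andP[sS sW]]; [exact: WA | by rewrite xS |].
  by move: xd (inDP _ _ yD sS sW) (inDP _ _ dD sS sW); rewrite -/d;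
    case: ifP => _; goal_lia.
have highD x : x \in W -> ~~ inD x || (x \in S) -> d < h x ->
    forall y, inD y -> h y < h x.
  move=> xW xD xd y yD.
  case xS: (x \in S).
    move: xd (inDP _ _ yD xS xW) (inDP _ _ dD xS xW); rewrite -/d.
    by case: ifP => _; goal_lia.
  rewrite xS orbF in xD.
  case: (notD x) => // [||s /andP[sS sW]]; [exact: WA | by rewrite xS |].
  by move: xd (inDP _ _ yD sS sW) (inDP _ _ dD sS sW); rewrite -/d;
    case: ifP => _; goal_lia.
have SnD s : s \in S -> s \in W -> ~~ inD s.
  move=> sS sW; apply/negP => sD; have := inDP _ _ sD sS sW.
  by rewrite ltnn; case: ifP.
(* The slot is flattened: everything in it, together with [Z2], moves to the level of [z1], so that
   arcs inside it cost nothing. *)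
pose h' x := if (x \in Z2) || inD x then d else h x.
have W2 x : x \in W -> (x \in Z2) = false by move=> xW; apply: (disjointFr dW2).
have h'W x : x \in W -> h' x = if inD x then d else h x.
  by move=> xW; rewrite /h' (W2 x xW).
have h'Z z : z \in Z2 -> h' z = d by rewrite /h' => ->.
exists h'.
  move=> s x sS sA xA xs.
  have sW : s \in W by move: sA; rewrite inE; case/orP => // /Z2S; rewrite sS.
  rewrite (h'W s) // (negPf (SnD _ sS sW)).
  have sd : d != h s.
    by have := inDP _ _ dD sS sW; rewrite -/d; case: ifP => _; goal_lia.
  move: xA; rewrite inE; case/orP => [xW|/h'Z ->//].
  by rewrite h'W //; case: ifP => // _; apply: sep => //; apply: WA.
apply: (leq_trans _ le_k); rewrite /B EA !card_back_arcsU //.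
have -> : #|back_arcs Z2 e2 h'| = 0.
  apply/eqP; rewrite cards_eq0; apply/eqP/setP => p; rewrite !inE.
  by apply/negP => /and4P[p1 p2 _]; rewrite !h'Z // ltnn.
apply: leq_add; first rewrite addn0; first apply: leq_trans (leq_addr _ _).
  apply: subset_leq_card; apply/subsetP => -[x y]; rewrite !inE /=.
  case/and4P => xW yW exy; rewrite xW yW eqe // exy /= !h'W //.
  case xD: (inD x); case yD: (inD y); rewrite ?ltnn //.
    by move=> lt; apply: lowD; rewrite ?yD.
  by move=> lt; apply: highD; rewrite ?xD.
apply: leq_sum => x xW; rewrite h'W //.
have small (Y : {set V}) (b : V -> bool) :
    (forall z, z \in Y -> b z -> (x, z) \in B) -> #|[set z in Y | b z]| <= k.
  move=> Hb; apply: leq_trans le_k; apply: (@card_le_preimage _ _ _ _ snd) => z.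
  by rewrite inE => /andP[zY bz]; exists (x, z) => //; apply: Hb.
have small' (Y : {set V}) (b : V -> bool) :
    (forall z, z \in Y -> b z -> (z, x) \in B) -> #|[set z in Y | b z]| <= k.
  move=> Hb; apply: leq_trans le_k; apply: (@card_le_preimage _ _ _ _ fst) => z.
  by rewrite inE => /andP[zY bz]; exists (z, x) => //; apply: Hb.
have E0 (b : V -> bool) (f : V -> bool) : (forall z, z \in Z2 -> ~~ f z) ->
    #|[set z in Z2 | b z && f z]| = 0.
  move=> Hf; apply/eqP; rewrite cards_eq0; apply/eqP/setP => z; rewrite !inE.
  by apply/negP => /and3P[/Hf /negPf ->].
case: ifP => xD.
  by rewrite !E0 //= => z zZ; rewrite h'Z // ltnn.
have nxD : ~~ inD x || (x \in S) by rewrite xD.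
case: (ltngtP (h x) d) => xd.
- rewrite [X in _ + X <= _]E0 ?addn0; last by move=> z zZ; rewrite h'Z // -leqNgt ltnW.
  have lt z : z \in Z1 -> h x < h z by move=> zZ; apply: lowD => //; apply: ZD.
  apply: leq_trans (leq_addr _ _).
  have -> : #|[set z in Z1 | e1 z x && (h x < h z)]| = #|[set z in Z1 | e1 z x]|.
    by apply: eq_card => z; rewrite !inE; case zZ: (z \in Z1); rewrite //= lt // andbT.
  (* All these arcs go down under [h], so their number is below the truncation at [k.+1], and
     equality of the truncated counts becomes equality of the counts. *)
  have le1 : #|[set z in Z1 | e1 z x]| <= k.
    by apply: small' => z zZ ezx; rewrite inE /= (ZA z) // (WA x) // ezx lt.
  move: le1 (outeq x xW).
  have : #|[set z in Z2 | e2 z x && (h x < h' z)]| <= #|[set z in Z2 | e2 z x]|.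
    by apply: subset_leq_card; apply/subsetP => z; rewrite !inE => /and3P[-> ->].
  by goal_lia.
- rewrite [X in X + _ <= _]E0 ?add0n; last by move=> z zZ; rewrite h'Z // -leqNgt ltnW.
  have lt z : z \in Z1 -> h z < h x by move=> zZ; apply: highD => //; apply: ZD.
  apply: leq_trans (leq_addl _ _).
  have -> : #|[set z in Z1 | e1 x z && (h z < h x)]| = #|[set z in Z1 | e1 x z]|.
    by apply: eq_card => z; rewrite !inE; case zZ: (z \in Z1); rewrite //= lt // andbT.
  have le1 : #|[set z in Z1 | e1 x z]| <= k.
    by apply: small => z zZ ezx; rewrite inE /= (ZA z) // (WA x) // ezx lt.
  move: le1 (ineq x xW).
  have : #|[set z in Z2 | e2 x z && (h' z < h x)]| <= #|[set z in Z2 | e2 x z]|.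
    by apply: subset_leq_card; apply/subsetP => z; rewrite !inE => /and3P[-> ->].
  by goal_lia.
- by rewrite !E0 // => z zZ; rewrite h'Z // xd ltnn.
Qed.

(* [2 c + 1] for a terminal and [2 c] for another vertex, where [c] counts the
   terminal in-neighbours: without S-triangles this orders everything forward. *)
Lemma solvable0_triangle_free X (e : rel V) : tournament_on X e ->
  (forall s x y, s \in S -> s \in X -> x \in X -> y \in X ->
     e s x -> e x y -> ~~ e y s) ->
  exists2 g, separated X g & forall x y, x \in X -> y \in X -> e x y -> g x <= g y.
Proof.
move=> [irr tot] tri.
pose N x := [set s in S :&: X | e s x].
pose g x := (#|N x|).*2 + (x \in S).
have sub x y : x \in X -> y \in X -> e x y -> N x \subset N y.
  move=> xX yX exy; apply/subsetP => s; rewrite !inE => /andP[/andP[sS sX] esx].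
  rewrite sS sX /=.
  have sy : s != y.
    apply: contraTneq exy => <-; apply/negP => exs; have := tot s x sX xX.
    case: eqVneq => [sx|_]; last by rewrite esx exs => /(_ isT).
    by move: esx (irr _ sX); rewrite -sx => ->.
  by rewrite tot //; apply: tri sS sX xX yX esx exy.
have prop x y : x \in X -> y \in X -> x \in S -> e x y -> g x < g y.
  move=> xX yX xS exy; rewrite /g xS.
  have: #|N x| < #|N y|.
    apply: proper_card; rewrite properE sub //=; apply/subsetPn; exists x.
      by rewrite !inE xS xX.
    by rewrite !inE xS xX /= irr.
  by case: (y \in S); lia.
have le x y : x \in X -> y \in X -> e x y -> g x <= g y.
  move=> xX yX exy; case xS: (x \in S); first exact/ltnW/prop.
  by rewrite /g xS; have := subset_leq_card (sub _ _ xX yX exy); lia.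
exists g => // s x sS sX xX xs.
case esx : (e s x); first by have := prop _ _ sX xX sS esx; lia.
have exs : e x s by rewrite tot // esx.
case xS: (x \in S); first by have := prop _ _ xX sX xS exs; lia.
by rewrite /g xS sS; lia.
Qed.


(* If the module [X] is not placed cleanly between its in- and out-neighbours,
   a free vertex [x0] of [X] shares its level with one of each; every vertex of
   [X] that is a terminal or is separated from [x0] by a terminal then pays. *)
Lemma solvable_module_del A X v (e : rel V) k : tournament_on A e ->
  X \subset A -> v \in X ->
  (forall y x x', y \in A -> y \notin X -> x \in X -> x' \in X -> e y x = e y x') ->
  (forall s x y, s \in S -> s \in X -> x \in X -> y \in X ->
     e s x -> e x y -> ~~ e y s) ->
  k < #|X :\ v| ->
  (forall x, x \in X :\ v -> x \notin S ->
     k < #|[set y in X :\ v | (y \in S) || ~~ same_type (A :\ v) e x y]|) ->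
  solvable (A :\ v) e k -> solvable A e k.
Proof.
move=> tour /subsetP XA vX mod tri bigX div [h sep le_k].
have [irr tot] := tour.
have XA' x : x \in X :\ v -> x \in A :\ v.
  by rewrite !inE => /andP[-> /XA].
have OA' y : y \in A -> y \notin X -> y \in A :\ v.
  by move=> yA yX; rewrite !inE yA andbT; apply: contraNneq yX => ->.
have X'X x : x \in X :\ v -> x \in X by rewrite inE => /andP[].
have A'A x : x \in A :\ v -> x \in A by rewrite inE => /andP[].
have OX y x : y \notin X -> x \in X -> x != y by move=> yX xX; apply: contraNneq yX => <-.
have modr y x : y \in A -> y \notin X -> x \in X -> e y x = e y v.
  by move=> yA yX xX; apply: mod.
have modl y x : y \in A -> y \notin X -> x \in X -> e x y = ~~ e y v.
  by move=> yA yX xX; rewrite tot ?OX ?modr //; apply: XA.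
set B := back_arcs _ _ _ in le_k.
(* An arc crossing the border of [X] charges its end in [X]; an arc inside [X] charges its head if
   its tail is a terminal, and its tail otherwise. *)
pose g (p : V * V) := if p.1 \notin X then p.2 else if p.2 \notin X then p.1
  else if p.1 \in S then p.2 else p.1.
pose C := g @: B.
have C_le : #|C| <= k by apply: leq_trans (leq_imset_card _ _) le_k.
have inB x y : x \in A :\ v -> y \in A :\ v -> e x y -> h y < h x -> (x, y) \in B.
  by move=> xA yA exy lt; rewrite inE /= xA yA exy.
have outl y x : y \in A -> y \notin X -> x \in X :\ v -> e y v -> h x < h y -> x \in C.
  move=> yA yX xX eyx lt; apply/imsetP; exists (y, x); last by rewrite /g /= yX.
  by apply: inB => //; [exact: OA'|exact: XA'|rewrite modr // X'X].
have outr y x : y \in A -> y \notin X -> x \in X :\ v -> ~~ e y v -> h y < h x -> x \in C.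
  move=> yA yX xX eyx lt; apply/imsetP; exists (x, y); last by rewrite /g /= yX (X'X x).
  by apply: inB => //; [exact: XA'|exact: OA'|rewrite modl // X'X].
have terl s x : s \in S -> s \in X :\ v -> x \in X :\ v -> x \notin S ->
    e s x -> h x < h s -> x \in C.
  move=> sS sX xX xS esx lt; apply/imsetP; exists (s, x).
    by apply: inB => //; apply: XA'.
  by rewrite /g /= !X'X // sS.
have terr s x : s \in S -> s \in X :\ v -> x \in X :\ v -> x \notin S ->
    e x s -> h s < h x -> x \in C.
  move=> sS sX xX xS esx lt; apply/imsetP; exists (x, s).
    by apply: inB => //; apply: XA'.
  by rewrite /g /= !X'X // (negPf xS).
have clean l r : l \in A -> r \in A -> l \notin X -> r \notin X -> e l v -> ~~ e r v ->
    h l < h r.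
  move=> lA rA lX rX el er; rewrite ltnNge; apply/negP => le_rl.
  have /subsetPn [x0 x0X x0C] : ~~ (X :\ v \subset C).
    by apply: contraTN bigX => /subset_leq_card; rewrite -leqNgt => /leq_trans; apply.
  have le_l0 : h l <= h x0 by rewrite leqNgt; apply: contra x0C; apply: outl.
  have le_0r : h x0 <= h r by rewrite leqNgt; apply: contra x0C; apply: outr.
  have El : h l = h x0 by move: le_rl le_l0 le_0r; goal_lia.
  have Er : h r = h x0 by move: le_rl le_l0 le_0r; goal_lia.
  have nSc s : s \in S -> s \in X :\ v -> h s != h x0.
    move=> sS sX; rewrite -El eq_sym; apply: sep => //; [exact: XA'|exact: OA'|].
    by rewrite eq_sym OX // X'X.
  have x0S : x0 \notin S by apply/negP => x0S; have := nSc _ x0S x0X; rewrite eqxx.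
  have := div _ x0X x0S; apply/negP; rewrite -leqNgt; apply: leq_trans C_le.
  apply: subset_leq_card; apply/subsetP => y; rewrite inE => /andP[yX yd].
  case: (ltngtP (h y) (h x0)) => hy.
  - by apply: (outl l); rewrite ?El.
  - by apply: (outr r); rewrite ?Er.
  have yS : y \notin S by apply/negP => yS; have := nSc _ yS yX; rewrite hy eqxx.
  move: yd; rewrite (negPf yS) /= negb_forall_in => /exists_inP [s].
  rewrite inE => /andP[sS sA] neq.
  have sX : s \in X.
    by apply: contraR neq => sX; rewrite (mod s x0 y) ?eqxx //; apply/A'A || apply/X'X.
  have sX' : s \in X :\ v by move: sA; rewrite !inE sX => /andP[->].
  have sc := nSc _ sS sX'.
  have nys : y != s by apply: contraNneq yS => ->.
  have nxs : x0 != s by apply: contraNneq x0S => ->.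
  case e0 : (e s x0) neq => /=.
    move=> nesy; have eys : e y s.
      rewrite tot ?(A'A s) ?(A'A _ (XA' _ yX)) //; by case: (e s y) nesy.
    apply: (terr s) => //; rewrite hy ltn_neqAle sc /= leqNgt.
    by apply: contra x0C; apply: (terl s).
  move=> esy; have {}esy : e s y by move: esy; case: (e s y).
  apply: (terl s) => //; rewrite hy ltn_neqAle eq_sym sc /= leqNgt.
  by apply: contra x0C; apply: (terr s) => //; rewrite tot ?e0 //; apply/A'A => //; apply/XA'.
have [f fsep fle] := solvable0_triangle_free (tournament_onS (introT subsetP XA) tour) tri.
(* [X] is inserted, in its own forward order [f], on the levels from [c] to [c + G - 1]: [c] is just
   above all in-neighbours, and the out-neighbours are raised by [G] to make room. *)
pose c := \max_(l in A :\: X | e l v) (h l).+1.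
pose G := (\max_(x in X) f x).+1.
have cl l : l \in A -> l \notin X -> e l v -> h l < c.
  by move=> lA lX el; rewrite /c (bigD1 l) ?inE ?lA ?lX ?el //= leq_maxl.
have cr r : r \in A -> r \notin X -> ~~ e r v -> c <= h r.
  move=> rA rX er; apply/bigmax_leqP => l /andP[]; rewrite inE => /andP[lX lA] el.
  exact: clean.
have fG x : x \in X -> f x < G by move=> xX; rewrite ltnS; apply: leq_bigmax_cond.
pose h' y := if y \in X then c + f y else if e y v then h y else h y + G.
have hX x : x \in X -> h' x = c + f x by rewrite /h' => ->.
have hO x : x \in A -> x \notin X ->
    [/\ e x v, h' x = h x & h x < c] \/ [/\ ~~ e x v, h' x = h x + G & c <= h x].
  move=> xA xX; rewrite /h' (negPf xX).
  case ex: (e x v); [left|right]; split=> //; [exact: cl|exact: cr (negbT ex)].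
exists h'.
  move=> s x sS sA xA xs.
  case sX: (s \in X); case xX: (x \in X).
  - by rewrite !hX // eqn_add2l; apply: fsep.
  - rewrite (hX s) //; have := fG _ sX.
    by case: (hO _ xA (negbT xX)) => -[_ ->]; goal_lia.
  - rewrite (hX x) //; have := fG _ xX.
    by case: (hO _ sA (negbT sX)) => -[_ ->]; goal_lia.
  have := sep s x sS (OA' _ sA (negbT sX)) (OA' _ xA (negbT xX)) xs.
  by case: (hO _ sA (negbT sX)) => -[_ ->]; case: (hO _ xA (negbT xX)) => -[_ ->];
     goal_lia.
apply: leq_trans le_k; apply: subset_leq_card; apply/subsetP => -[x y].
rewrite inE /= => /and4P[xA yA exy]; case xX: (x \in X); case yX: (y \in X).
- by rewrite !hX // ltn_add2l ltnNge fle.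
- rewrite (hX x) //; have := fG _ xX; move: exy; rewrite modl ?yX //.
  by case: (hO _ yA (negbT yX)) => -[eyv ->]; move: eyv; case: (e y v) => // _; goal_lia.
- rewrite (hX y) //; have := fG _ yX; move: exy; rewrite modr ?xX //.
  by case: (hO _ xA (negbT xX)) => -[eyv ->]; move: eyv; case: (e x v) => // _; goal_lia.
rewrite inE /= exy !OA' ?xX ?yX //=.
by case: (hO _ xA (negbT xX)) => -[_ ->]; case: (hO _ yA (negbT yX)) => -[_ ->];
  goal_lia.
Qed.

End Levels.

(** * Size of irreducible instances *)

Section Bound.
Variables (V : finType) (S : {set V}).
Implicit Types (A X : {set V}) (e : rel V) (k : nat).

Definition class A e x : {set V} := [set y in A | (y \notin S) && same_type S A e x y].

Definition core A e k x : {set V} :=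
  [set z in class A e x | (k < #|[set y in class A e x | e y z]|) &&
                          (k < #|[set y in class A e x | e z y]|)].

Definition between A e u w : {set V} :=
  [set x in A | [|| x == u, x == w | e u x && e x w]].

Definition clean_module A e X : bool :=
  [forall y in A, (y \notin X) ==>
     [forall x in X, forall x' in X, e y x == e y x']] &&
  [forall s in S :&: X, forall x in X, forall y in X, e s x ==> e x y ==> ~~ e y s].

(** A set of [b] vertices spans [b (b - 1) / 2] arcs, but outdegrees at most [k] allow only [k b] of
    them. *)
Lemma card_low_degree (M : {set V}) e k : tournament_on M e ->
  #|[set y in M | #|[set x in M | e x y]| <= k]| <= k.*2.+1.
Proof.
move=> [irr tot]; set Y := [set y in M | _].
have YM y : y \in Y -> y \in M by rewrite inE => /andP[].
have le1 : \sum_(y in Y) \sum_(x in Y) (e x y : nat) <= k * #|Y|.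
  rewrite mulnC -sum_nat_const; apply: leq_sum => y.
  rewrite inE => /andP[yM]; apply: leq_trans; rewrite -sum1_card.
  rewrite big_mkcond [X in _ <= X]big_mkcond /=; apply: leq_sum => x _.
  by rewrite !inE; case: (x \in M) => //=; case: (e x y) => //=; case: (_ <= k).
have E : \sum_(y in Y) \sum_(x in Y) (e x y + e y x) + #|Y| = #|Y| * #|Y|.
  rewrite -[X in _ + X]sum1_card -big_split /= -[RHS]sum_nat_const; apply: eq_bigr => y yY.
  rewrite -[RHS]sum1_card (bigD1 y) //= [RHS](bigD1 y) //= (negPf (irr y (YM _ yY))) /=.
  rewrite add0n addnC; congr (_ + _); apply: eq_bigr => x /andP[xY xy].
  by rewrite (tot x y) ?YM //; case: (e y x).
have E2 : \sum_(y in Y) \sum_(x in Y) (e x y + e y x) =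
    2 * \sum_(y in Y) \sum_(x in Y) (e x y : nat).
  under eq_bigr => y _ do rewrite big_split /=.
  by rewrite big_split /= [X in _ + X]exchange_big /= mul2n addnn.
rewrite E2 in E; move: le1 E.
move: (\sum_(y in Y) _) #|Y| => a b; clear; case: b => [|b]; first lia.
by rewrite -mul2n => le1 E; rewrite ltnS -(leq_pmul2r (m := b.+1)) //; nia.
Qed.

(** A vertex of the class outside the core has low out- or indegree there, with at most [2 k + 1]
    vertices of either kind, and [7 k + 5 = (3 k + 3) + 2 (2 k + 1)]. *)
Lemma card_class_le A e k x : tournament_on A e ->
  #|core A e k x| <= 3 * k + 3 -> #|class A e x| <= 7 * k + 5.
Proof.
move=> tour; set M := class A e x => cle.
have sMA : M \subset A by apply/subsetP => y; rewrite inE => /andP[].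
have tM := tournament_onS sMA tour.
have tM' : tournament_on M (fun a b => e b a).
  by case: tM => irr tot; split=> // a b aM bM ab; rewrite tot // eq_sym.
have H1 := card_low_degree k tM; have H2 := card_low_degree k tM'.
have H3 := cardsUI (core A e k x) [set y in M | #|[set x in M | e x y]| <= k].
have H4 := cardsUI (core A e k x :|: [set y in M | #|[set x in M | e x y]| <= k])
   [set y in M | #|[set x in M | e y x]| <= k].
have : M \subset (core A e k x :|: [set y in M | #|[set x in M | e x y]| <= k]) :|:
   [set y in M | #|[set x in M | e y x]| <= k].
  apply/subsetP => y yM; rewrite [y \in _]inE [X in X || _]inE [X in X || _ || _]inE.
  rewrite yM [X in _ || X || _]inE [X in _ || _ || X]inE yM /= -/M.
  by rewrite !ltnNge; do 2!case: (_ <= k).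
move/subset_leq_card; move: cle H1 H2 H3 H4; rewrite /=; goal_lia.
Qed.

Lemma card_cover_le (I T : finType) (J : {set I}) (Y : {set T}) (F : I -> {set T}) b :
  (forall y, y \in Y -> exists2 i, i \in J & y \in F i) ->
  (forall i, i \in J -> #|F i| <= b) -> #|Y| <= #|J| * b.
Proof.
move=> cov bnd; rewrite -sum_nat_const; apply: leq_trans (leq_sum _ bnd).
under eq_bigr => i _ do rewrite -sum1_card big_mkcond /=.
rewrite exchange_big /= -sum1_card big_mkcond /=; apply: leq_sum => y _.
by case: ifP => // /cov [i iJ yF]; rewrite (bigD1 i) //= yF.
Qed.

(* [P] collects the ends of the back arcs of a solution, so that an S-triangle
   has at least two vertices in [P] and the vertices of [U = A :\: P] are
   linearly arranged by the number [pos] of terminals of [U] before them.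
   [O] is the set of the positions taken by [P]. *)
Theorem card_irreducible A e k : tournament_on A e -> solvable S A e k ->
  (forall x, x \in A -> x \notin S -> #|class A e x| <= 7 * k + 5) ->
  (forall u w, u \in S -> w \in S -> u \in A -> w \in A ->
     clean_module A e (between A e u w) -> #|between A e u w| <= 8 * k + 6) ->
  #|A| <= 128 * (k ^ 2 + 1).
Proof.
move=> [irr tot] [h sep le_k] hcls hmod.
have asym x y : x \in A -> y \in A -> e x y -> ~~ e y x.
  move=> xA yA exy; have xy : y != x by apply: contraTneq exy => ->; apply: irr.
  by rewrite tot // negbK.
set B := back_arcs A e h in le_k.
pose P := (fst @: B) :|: (snd @: B).
have P_le : #|P| <= 2 * k.
  rewrite mul2n -addnn; apply: leq_trans (leq_card_setU _ _) _.
  by apply: leq_add; apply: leq_trans (leq_imset_card _ _) le_k.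
have inP x y : x \in A -> y \in A -> e x y -> h y < h x -> (x \in P) && (y \in P).
  move=> xA yA exy lt; have xyB : (x, y) \in B by rewrite inE /= xA yA exy.
  by rewrite !inE (imset_f fst xyB) (imset_f snd xyB) orbT.
have BA s : s \in P -> s \in A.
  by rewrite !inE; case/orP => /imsetP [p]; rewrite inE => /and4P[? ? _ _] ->.
clearbody P.
(* One of the three arcs goes down and so has both ends in [P]; otherwise all three levels would
   agree, although [a] is a terminal. *)
have triP a b c : a \in S -> a \in A -> b \in A -> c \in A ->
    e a b -> e b c -> e c a ->
    [|| (a \in P) && (b \in P), (b \in P) && (c \in P) | (c \in P) && (a \in P)].
  move=> aS aA bA cA eab ebc eca.
  case: (ltnP (h b) (h a)) => [/inP -> //|h1].
  case: (ltnP (h c) (h b)) => [/inP -> //|h2]; first by rewrite orbT.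
  case: (ltnP (h a) (h c)) => [/inP -> //|h3]; first by rewrite !orbT.
  have : h b != h a.
    by apply: sep => //; apply: contraTneq eab => ->; apply: irr.
  by move: h1 h2 h3; goal_lia.
pose SU := [set s in S :&: A | s \notin P].
have SUP s : s \in SU -> [/\ s \in S, s \in A & s \notin P].
  by rewrite !inE => /andP[/andP[]].
(* One end outside [P] is enough, since a triangle at [s], which avoids [P], would put both [x] and
   [y] into [P]. *)
have trans s x y : s \in SU -> x \in A -> y \in A -> (x \notin P) || (y \notin P) ->
    e s x -> e x y -> e s y.
  move=> /SUP [sS sA sP] xA yA xyP esx exy.
  have sy : s != y.
    by apply: contraTneq exy => <-; apply: asym.
  rewrite tot //; apply/negP => eys.
  have := triP _ _ _ sS sA xA yA esx exy eys; rewrite (negPf sP) /= andbF orbF.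
  by case/andP=> xP yP; move: xyP; rewrite xP yP.
pose Nb x := [set s in SU | e s x].
pose pos x := #|Nb x|.
have Nb_sub x y : x \in A -> y \in A -> (x \notin P) || (y \notin P) -> e x y ->
    Nb x \subset Nb y.
  move=> xA yA xyP exy; apply/subsetP => s; rewrite ![_ \in Nb _]inE => /andP[sSU esx].
  by rewrite sSU /=; apply: trans exy.
have pos_le x y : x \in A -> y \in A -> (x \notin P) || (y \notin P) -> e x y ->
    pos x <= pos y.
  by move=> xA yA xyP exy; apply: subset_leq_card; apply: Nb_sub.
have pos_lt s x : s \in SU -> x \in A -> e s x -> pos s < pos x.
  move=> sSU xA esx; have [sS sA sP] := SUP _ sSU.
  apply: proper_card; rewrite properE Nb_sub ?sP //=; apply/subsetPn; exists s.
    by rewrite inE sSU.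
  by rewrite inE sSU /= irr.
(* The position decides on which side of every terminal of [SU] a vertex lies, also for the vertices
   of [P]. *)
have eS s x : s \in SU -> x \in A -> e s x = (pos s < pos x).
  move=> sSU xA; have [sS sA sP] := SUP _ sSU.
  apply/idP/idP; first exact: pos_lt.
  case: (eqVneq s x) => [->|sx]; first by rewrite ltnn.
  by rewrite tot // ltnNge; apply: contra => exs; apply: pos_le; rewrite ?sP ?orbT.
have pos_arc x y : x \in A -> y \in A -> (x \notin P) || (y \notin P) ->
    pos x < pos y -> e x y.
  move=> xA yA xyP lt; have xy : x != y by apply: contraTneq lt => ->; rewrite ltnn.
  rewrite tot //; apply: contraTN lt => eyx; rewrite -leqNgt; apply: pos_le => //.
  by rewrite orbC.
have pos_inj : {in SU &, injective pos}.
  move=> s t sSU tSU Est; apply/eqP; apply: contra_eqT Est => st.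
  have [_ sA _] := SUP _ sSU; have [_ tA _] := SUP _ tSU.
  have := eS _ _ sSU tA; have := eS _ _ tSU sA; rewrite (tot s t) //.
  by case: (ltngtP (pos s) (pos t)) => //= _ ->.
pose m := #|SU|.
have pos_m x : pos x <= m.
  by apply: subset_leq_card; apply/subsetP => s; rewrite inE => /andP[].
have posS s : s \in SU -> pos s < m.
  move=> sSU; have [_ sA _] := SUP _ sSU.
  apply: proper_card; rewrite properE; apply/andP; split.
    by apply/subsetP => t; rewrite inE => /andP[].
  by apply/subsetPn; exists s; rewrite // inE sSU /= irr.
have pos_ex j : j < m -> exists2 s, s \in SU & pos s = j.
  move=> jm; have: j \in [seq pos s | s <- enum SU].
    have [|||_ ->] := @uniq_min_size _ [seq pos s | s <- enum SU] (iota 0 m).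
    - rewrite map_inj_in_uniq ?enum_uniq // => s t; rewrite !mem_enum; exact: pos_inj.
    - move=> i /mapP [s]; rewrite mem_enum => sSU ->.
      by rewrite mem_iota /= add0n posS.
    - by rewrite size_map size_iota -cardE.
    by rewrite mem_iota.
  by case/mapP => s; rewrite mem_enum => sSU ->; exists s.
pose q x : 'I_m.+1 := inord (pos x).
have qE x : q x = pos x :> nat by rewrite inordK // ltnS.
(* The extreme positions are included so that a non-terminal outside [P] with its position outside
   [O] has terminals of [SU] on both sides. *)
pose O := [set ord0; ord_max] :|: (q @: P).
have O_le : #|O| <= 2 * k + 2.
  rewrite addnC; apply: leq_trans (leq_card_setU _ _) _; apply: leq_add.
    by rewrite cards2; case: (_ != _).
  exact: leq_trans (leq_imset_card _ _) P_le.
have O0 : ord0 \in O by rewrite !inE.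
have Om : ord_max \in O by rewrite !inE eqxx orbT.
have OP x : x \in P -> q x \in O by move=> xP; rewrite inE (imset_f q xP) orbT.
pose C1 := [set x in A | [&& x \notin P, x \notin S & q x \in O]].
pose C2 := [set x in A | (x \notin P) && ((x \in S) || (q x \notin O))].
have A_le : #|A| <= #|P| + #|C1| + #|C2|.
  have : A \subset (P :|: C1) :|: C2.
    apply/subsetP => x xA; rewrite [_ \in _ :|: _]inE [_ \in _ :|: _]inE.
    rewrite [_ \in C1]inE [_ \in C2]inE xA /=.
    by case: (x \in P); case: (x \in S); case: (q x \in O).
  move/subset_leq_card/leq_trans; apply; apply: leq_trans (leq_card_setU _ _) _.
  by rewrite leq_add2r leq_card_setU.
have C1_le : #|C1| <= (4 * k + 3) * (7 * k + 5).
  (* Along an arc inside [C1] both [lo] and [sp] can only grow as sets. If the sum of their sizes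
     stays the same, so do both sets, and with them the type. The sum has at most
     [(2 k + 2) + 2 k + 1] values, each contributing one class. *)
  pose lo x := [set o in O | o <= pos x].
  pose sp x := [set s in S :&: P | e s x].
  have chi_lt x : #|lo x| + #|sp x| < 4 * k + 3.
    have : #|lo x| <= #|O| by apply/subset_leq_card/subsetP => o; rewrite inE => /andP[].
    have : #|sp x| <= #|P|.
      by apply/subset_leq_card/subsetP => o; rewrite !inE -andbA => /and3P[].
    by move: O_le P_le; goal_lia.
  have -> : 4 * k + 3 = #|[set: 'I_(4 * k + 3)]| by rewrite cardsT card_ord.
  apply: (@card_cover_le _ _ _ _
    (fun i : 'I_(4 * k + 3) => [set x in C1 | #|lo x| + #|sp x| == i])).
    by move=> x xC; exists (Ordinal (chi_lt x)); rewrite // inE xC /=.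
  move=> i _; set F := [set x in C1 | _].
  case: (set_0Vmem F) => [-> //|[x0]]; first by rewrite cards0.
  rewrite inE => /andP[x0C /eqP Ex0].
  have C1P x : x \in C1 -> [/\ x \in A, x \notin P, x \notin S & q x \in O].
    by rewrite inE => /and4P[].
  have key x y : x \in C1 -> y \in C1 -> #|lo x| + #|sp x| = #|lo y| + #|sp y| ->
      e x y -> same_type S A e x y.
    move=> /C1P [xA xP xS xO] /C1P [yA yP yS yO] E exy.
    have mono s : s \in S -> s \in A -> e s x -> e s y.
      move=> sS sA esx; rewrite tot //; last by apply: contraNneq yS => <-.
      apply/negP => eys; have := triP _ _ _ sS sA xA yA esx exy eys.
      by rewrite (negPf xP) (negPf yP) /= andbF.
    have xyP : (x \notin P) || (y \notin P) by rewrite xP.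
    have le_pos := pos_le _ _ xA yA xyP exy.
    have sub1 : lo x \subset lo y.
      apply/subsetP => o; rewrite !inE => /andP[-> /=] h1; exact: leq_trans le_pos.
    have sub2 : sp x \subset sp y.
      apply/subsetP => s; rewrite !inE => /andP[/andP[sS sP] esx].
      by rewrite sS sP mono // BA.
    have le1 := subset_leq_card sub1; have le2 := subset_leq_card sub2.
    have E1 : #|lo x| = #|lo y| by move: E le1 le2; goal_lia.
    have E2 : #|sp x| = #|sp y| by move: E le1 le2; goal_lia.
    have {}E1 : lo x = lo y by apply/eqP; rewrite eqEcard sub1 E1 leqnn.
    have {}E2 : sp x = sp y by apply/eqP; rewrite eqEcard sub2 E2 leqnn.
    have le_pos' : pos y <= pos x.
      have : q y \in lo x by rewrite E1 inE yO qE leqnn.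
      by rewrite inE qE => /andP[].
    have E3 : Nb x = Nb y.
      by apply/eqP; rewrite eqEcard Nb_sub.
    apply/forall_inP => s; rewrite inE => /andP[sS sA]; apply/eqP.
    case sP: (s \in P).
      by move/setP/(_ s): E2; rewrite !inE sS sP.
    by move/setP/(_ s): E3; rewrite !inE sS sA sP.
  have sym x y : same_type S A e x y -> same_type S A e y x.
    by move=> /forall_inP H; apply/forall_inP => s /H; rewrite eq_sym.
  have [x0A _ x0S _] := C1P _ x0C.
  apply: leq_trans (hcls x0 x0A x0S); apply: subset_leq_card.
  apply/subsetP => x; rewrite inE => /andP[xC /eqP Ex].
  have [xA _ xS _] := C1P _ xC; rewrite inE xA xS /=.
  case: (eqVneq x0 x) => [->|ne]; first by apply/forall_inP.
  case exx: (e x0 x); first by apply: key => //; rewrite Ex0 Ex.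
  by apply: sym; apply: key => //; rewrite ?Ex0 ?Ex // tot ?exx // eq_sym.
have C2_le : #|C2| <= (2 * k + 2) * (8 * k + 6).
  apply: leq_trans (leq_mul O_le (leqnn _)).
  (* [F o] covers the positions from [o] up to, but excluding, the next element of [O]. *)
  pose F (o : 'I_m.+1) := [set x in C2 | (o <= pos x) &&
     [forall o' in O, (o < o') ==> (pos x < o')]].
  apply: (@card_cover_le _ _ _ _ F).
    move=> x xC.
    have P0 : (ord0 \in O) && ((ord0 : 'I_m.+1) <= pos x) by rewrite O0.
    case: (@arg_maxnP _ (ord0 : 'I_m.+1) (fun o => (o \in O) && (o <= pos x)) val P0).
    move=> o /andP[oO ox] omax; exists o => //; rewrite inE xC ox /=.
    apply/forall_inP => o' o'O; apply/implyP => lt; rewrite ltnNge.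
    by apply: contraTN lt => le; rewrite -leqNgt; apply: omax; rewrite o'O.
  move=> o oO; case: (set_0Vmem (F o)) => [->|[x1 x1F]]; first by rewrite cards0.
  have FP x : x \in F o -> [/\ x \in A, x \notin P, (x \in S) || (q x \notin O),
      o <= pos x & forall o', o' \in O -> o < o' -> pos x < o'].
    rewrite inE => /andP[]; rewrite inE => /and3P[xA xP xSO] /andP[ox /forall_inP H].
    by split=> // o' /H /implyP.
  have SUF s : s \in SU -> o <= pos s ->
      (forall o' : 'I_m.+1, o' \in O -> o < o' -> pos s < o') -> s \in F o.
    move=> /SUP [sS sA sP] os H; rewrite inE [_ \in C2]inE sS sA sP os /=.
    by apply/forall_inP => o' o'O; apply/implyP; apply: H.
  have nt x : x \in F o -> x \notin S -> [/\ o < pos x & pos x < m].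
    move=> /FP [xA xP + ox _] xS; rewrite (negPf xS) /= => qx; split.
      rewrite ltn_neqAle ox andbT; apply: contraNneq qx => E.
      by have -> : q x = o by apply: val_inj; rewrite /= qE.
    rewrite ltn_neqAle pos_m andbT; apply: contraNneq qx => E.
    by have -> : q x = ord_max by apply: val_inj; rewrite /= qE.
  have FSU x : x \in F o -> x \in S -> x \in SU.
    by move=> /FP [xA xP _ _ _] xS; rewrite !inE xA xS xP.
  have om : o < m.
    have [_ _ _ ox _] := FP _ x1F; apply: leq_ltn_trans ox _.
    by case x1S: (x1 \in S); [apply/posS/FSU | case: (nt x1 x1F (negbT x1S))].
  (* The terminal at position [o] opens the interval around [F o]; the last terminal of [F o] will
     close it. *)
  have [u uSU pu] := pos_ex _ om.
  have uF : u \in F o by apply: SUF; rewrite ?pu.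
  have P0 : (u \in F o) && (u \in SU) by rewrite uF.
  case: (@arg_maxnP _ u (fun x => (x \in F o) && (x \in SU)) pos P0).
  move=> w /andP[wF wSU] wmax.
  have [uS uA uP] := SUP _ uSU; have [wS wA wP] := SUP _ wSU.
  have posw x : x \in F o -> pos x <= pos w.
    move=> xF; case xS: (x \in S); first by apply: wmax; rewrite xF FSU.
    have [ox xm] := nt _ xF (negbT xS); have [t tSU pt] := pos_ex _ xm.
    rewrite -pt; apply: wmax; rewrite tSU andbT; apply: SUF; rewrite ?pt //.
      exact: ltnW.
    by have [] := FP _ xF.
  have sub : F o \subset between A e u w.
    apply/subsetP => x xF; have [xA xP _ ox _] := FP _ xF; rewrite inE xA /=.
    case: (eqVneq x u) => //= xu; case: (eqVneq x w) => //= xw.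
    rewrite (tot x w) // !eS // -leqNgt posw // andbT pu.
    case xS: (x \in S); last by have [] := nt _ xF (negbT xS).
    rewrite ltn_neqAle ox andbT -pu; apply: contra_neqN xu => /eqP.
    by move/pos_inj => -> //; apply: FSU.
  apply: leq_trans (subset_leq_card sub) _; apply: hmod => //.
  have uw : pos u <= pos w by apply: posw.
  (* The interval avoids [P]: a vertex of [P] in it would give an element of [O] after [o] and not
     beyond [pos w]. Avoiding [P] then yields both the module property and the absence of
     S-triangles. *)
  have bP x : x \in between A e u w ->
      [/\ x \in A, x \notin P, o <= pos x, pos x <= pos w & (x != u -> o < pos x)].
    rewrite inE => /andP[xA]; case: (eqVneq x u) => [->|xu] /=.
      by rewrite pu; split=> //; rewrite -pu.
    case: (eqVneq x w) xu => [-> xu|xw xu] /=.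
      move=> _; split=> //; first by rewrite -pu.
      move=> _; rewrite ltn_neqAle -pu uw andbT.
      by apply: contra_neq xu => /pos_inj ->.
    rewrite eS // pu => /andP[ox exw].
    have le : pos x <= pos w by apply: pos_le; rewrite ?wP ?orbT.
    split=> //; last exact: ltnW.
    apply/negP => xP; have [_ _ _ _ H] := FP _ wF.
    by have := H _ (OP _ xP); rewrite qE => /(_ ox); rewrite ltnNge le.
  apply/andP; split.
    apply/forall_inP => y yA; apply/implyP => yI.
    have yu : y != u by apply: contraNneq yI => ->; rewrite inE uA eqxx.
    have yw : y != w by apply: contraNneq yI => ->; rewrite inE wA eqxx orbT.
    apply/forall_inP => x xI; apply/forall_inP => x' x'I; apply/eqP.
    have eyx z : z \in between A e u w -> e y z = ~~ e u y.
      move=> zI; have [zA zP oz zw zu] := bP _ zI.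
      case euy: (e u y) => /=.
        have ewy : e w y.
          rewrite tot //; last by rewrite eq_sym.
          by apply: contra yI => eyw; rewrite inE yA euy eyw !orbT.
        apply/negbTE/asym => //; apply: pos_arc; rewrite ?zP //.
        by apply: leq_ltn_trans zw _; rewrite -eS.
      case: (eqVneq z u) => [->|zu']; first by rewrite tot // euy.
      apply: pos_arc; rewrite ?zP ?orbT //; apply: leq_ltn_trans (zu zu').
      by rewrite -pu leqNgt -eS // euy.
    by rewrite !eyx.
  apply/forall_inP => s; rewrite inE => /andP[sS sI]; apply/forall_inP => x xI.
  apply/forall_inP => y yI; apply/implyP => esx; apply/implyP => exy; apply/negP => eys.
  have [sA sP _ _ _] := bP _ sI; have [xA xP _ _ _] := bP _ xI.
  have [yA yP _ _ _] := bP _ yI.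
  by have := triP _ _ _ sS sA xA yA esx exy eys; rewrite (negPf sP) (negPf xP) (negPf yP).
(* The three bounds add up to [44 k^2 + 71 k + 27]. Since [k = 1] already rules out 64, 128 is the
   least power of two that works; a power of two is convenient because the program obtains the
   factor by doubling. *)
apply: leq_trans A_le _; move: P_le C1_le C2_le; rewrite expnS expn1; clear; nia.
Qed.

End Bound.

(** * Reduction rules *)

(** Of the at least [8 k + 6] vertices left in the interval, at most [7 k + 5] are non-terminals of
    the type of a given non-terminal [x]; the more than [k] others are those that pay in the
    exchange argument. *)
Lemma module_rule (V : finType) (S A : {set V}) (e : rel V) k u w :
  tournament_on A e -> u \in S -> w \in S -> u \in A -> w \in A ->
  (forall x, x \in A -> x \notin S -> #|class S A e x| <= 7 * k + 5) ->
  clean_module S A e (between A e u w) -> 8 * k + 6 < #|between A e u w| ->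
  solvable S A e k <-> solvable S (A :\ u) e k.
Proof.
move=> tour uS wS uA wA hcls /andP[/forall_inP mod /forall_inP tri] big.
have [irr tot] := tour; set X := between A e u w in mod tri big.
split; first by apply: solvableS; apply/subsetP => x; rewrite inE => /andP[].
have uX : u \in X by rewrite inE uA eqxx.
have wX : w \in X by rewrite inE wA eqxx orbT.
have tri' s x y : s \in S -> s \in X -> x \in X -> y \in X -> e s x -> e x y -> ~~ e y s.
  move=> sS sX xX yX esx exy; have := tri s; rewrite inE sS sX => /(_ isT).
  by move/forall_inP/(_ x xX)/forall_inP/(_ y yX); rewrite esx exy.
(* [between] does not ask for this arc: the size gives a third vertex [x] with [u -> x -> w], and
   [w -> u] would close an S-triangle. *)
have euw : e u w.
  have /subsetPn [x xX] : ~~ (X \subset [set u; w]).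
    apply: contraTN big => /subset_leq_card; rewrite -leqNgt cards2.
    by case: (u != w) => /leq_trans; apply; goal_lia.
  move: (xX); rewrite !inE => /andP[xA /orP[->//|/orP[->|/andP[eux exw]]]].
    by rewrite orbT.
  move=> _; have := tri' u x w uS uX xX wX eux exw.
  case: (eqVneq u w) => [E|uw]; last by rewrite (tot u w).
  move: exw; rewrite -E tot ?eux //.
  by apply: contraTneq eux => ->; apply: irr.
have eu x : x \in X -> x != u -> e u x.
  rewrite inE => /andP[_ /orP[/eqP ->|/orP[/eqP ->|/andP[]]]] //.
  by rewrite eqxx.
apply: (@solvable_module_del _ _ _ X) => //.
- by apply/subsetP => x; rewrite inE => /andP[].
- move=> y x x' yA yX xX x'X; have := mod y yA; rewrite yX.
  by move/forall_inP/(_ x xX)/forall_inP/(_ x' x'X)/eqP.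
- by move: big; rewrite (cardsD1 u X) uX; goal_lia.
move=> x; rewrite !inE -/X => /andP[xu /andP[xA xb]] xS.
have xX : x \in X by rewrite inE xA xb.
set Y := [set y in _ | _].
have sub : X :\ u \subset Y :|: class S A e x.
  apply/subsetP => y; rewrite inE => /andP[yu yX].
  have yA : y \in A by move: yX; rewrite inE => /andP[].
  move: yu; rewrite inE => yu.
  have yX' : y \in X :\ u by rewrite !inE yu; rewrite inE in yX.
  rewrite inE; apply/orP; case yS: (y \in S); first by left; rewrite inE yX' yS.
  case st: (same_type S (A :\ u) e x y); last by left; rewrite inE yX' yS st.
  right; rewrite inE yA yS /=; apply/forall_inP => s; rewrite inE => /andP[sS sA].
  (* Deleting [u] does not merge types within the interval, because [u] dominates all its other
     vertices. *)
  case: (eqVneq s u) => [->|su]; first by rewrite !eu.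
  by apply: (forall_inP st); rewrite !inE sS sA su.
have := subset_leq_card sub; have := (leq_card_setU Y (class S A e x)).1.
have := hcls x xA xS; move: big; rewrite (cardsD1 u X) uX.
goal_lia.
Qed.

(** * Numbering the elements of a set of vertices *)

Section Rank.
Variable N : nat.
Implicit Types (Z : {set 'I_N}).

(** A numbering of [Z] by [0], ..., [#|Z| - 1] that a bounded sum can compute. *)
Definition rank Z (x : 'I_N) : nat := #|[set z in Z | z < x]|.

Lemma rank_lt Z (x y : 'I_N) : x \in Z -> x < y -> rank Z x < rank Z y.
Proof.
move=> xZ xy; apply: proper_card; rewrite properE; apply/andP; split.
  by apply/subsetP => z; rewrite !inE => /andP[-> /ltn_trans]; apply.
by apply/subsetPn; exists x; rewrite inE xZ ?xy //= ltnn.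
Qed.

Lemma rank_inj Z : {in Z &, injective (rank Z)}.
Proof.
move=> x y xZ yZ E; apply: val_inj => /=; case: (ltngtP x y) => // lt.
  by have := rank_lt xZ lt; rewrite E ltnn.
by have := rank_lt yZ lt; rewrite E ltnn.
Qed.

Lemma rank_max Z x : x \in Z -> rank Z x < #|Z|.
Proof.
move=> xZ; apply: proper_card; rewrite properE; apply/andP; split.
  by apply/subsetP => z; rewrite inE => /andP[].
by apply/subsetPn; exists x; rewrite // inE xZ ltnn.
Qed.

Lemma card_rank Z (P : pred nat) :
  #|[set z in Z | P (rank Z z)]| = count P (iota 0 #|Z|).
Proof.
have perm : perm_eq [seq rank Z z | z <- enum Z] (iota 0 #|Z|).
  have U : uniq [seq rank Z z | z <- enum Z].
    by rewrite map_inj_in_uniq ?enum_uniq // => x y; rewrite !mem_enum; exact: rank_inj.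
  have [|||_ E] := @uniq_min_size _ [seq rank Z z | z <- enum Z] (iota 0 #|Z|) => //.
  - by move=> i /mapP [s]; rewrite mem_enum => sZ ->; rewrite mem_iota rank_max.
  - by rewrite size_map size_iota -cardE.
  by apply: uniq_perm => //; rewrite iota_uniq.
rewrite -(permP perm) count_map -size_filter cardE.
apply: perm_size; apply: uniq_perm.
- exact: enum_uniq.
- exact/filter_uniq/enum_uniq.
by move=> z; rewrite mem_enum mem_filter inE mem_enum /= andbC.
Qed.

Lemma count_iota_ge (P : pred nat) a b m :
  a <= b <= m -> (forall t, a <= t < b -> P t) -> b - a <= count P (iota 0 m).
Proof.
move=> /andP[ab bm] HP.
have -> : m = a + ((b - a) + (m - b)) by move: ab bm; goal_lia.
rewrite iotaD !count_cat [iota (0 + a) _]iotaD count_cat.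
have -> : count P (iota (0 + a) (b - a)) = b - a.
  rewrite -[RHS](size_iota (0 + a)); apply/eqP; rewrite -all_count; apply/allP => t.
  by rewrite mem_iota => /andP[h1 h2]; apply: HP; move: h1 h2 ab; goal_lia.
by goal_lia.
Qed.

Lemma count_iota_lt n m : count (fun r => r < n) (iota 0 m) = minn n m.
Proof.
elim: m => [|m IH]; first by rewrite minn0.
by rewrite -addn1 iotaD count_cat IH /=; case: ltnP; lia.
Qed.

End Rank.

(** * Replacing a large core by a smaller one *)

Section ClassRule.
Variables (N : nat) (S : {set 'I_N}).
Implicit Types (A Z : {set 'I_N}) (e : rel 'I_N) (k : nat).

(* A tournament on the ranks in which, among at least [3 (k + 1)] ranks, all
   in- and outdegrees exceed [k]: three consecutive intervals, each dominating
   the next one cyclically. *)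
Definition cyclic_arc k (r t : nat) : bool :=
  if (r <= k) && (k.*2.+2 <= t) then false
  else if (t <= k) && (k.*2.+2 <= r) then true else r < t.

(** The deleted core vertex is taken from the larger side: an in-neighbour of [x] if at least
    [k + 1] remain, else an out-neighbour, of which more than [k] remain as [#|Z| > 3 k + 3].
    Truncated at [k + 1], both numbers are unchanged. *)
Definition reduced_indegree e Z k (x : 'I_N) : nat :=
  let n := #|[set z in Z | e z x]| in if k.+1 < n then n.-1 else n.

(** Since only numbers of arcs matter, the core vertices dominating an outside vertex may be taken
    to be those of smallest rank, which needs no choice. *)
Definition rewired e Z k : rel 'I_N := fun x y =>
  if x \in Z then
    if y \in Z then cyclic_arc k (rank Z x) (rank Z y)
    else rank Z x < reduced_indegree e Z k y
  else if y \in Z then ~~ (rank Z y < reduced_indegree e Z k x) else e x y.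

(** Both directions are exchanges of [Z] and [Z :\ z0] against the common part [A :\: Z]. As [z0]
    has the highest rank, the surviving ranks are again an initial segment, and all new counts are
    minima or differences. *)
Lemma class_rule A e k x0 z0 : tournament_on A e -> x0 \in A -> x0 \notin S ->
  let Z := core S A e k x0 in
  3 * k + 3 < #|Z| -> z0 \in Z -> rank Z z0 = #|Z|.-1 ->
  tournament_on (A :\ z0) (rewired e Z k) /\
  (solvable S A e k <-> solvable S (A :\ z0) (rewired e Z k) k).
Proof.
move=> tour x0A x0S Z big z0Z rz0; have [irr tot] := tour.
set m := #|Z| in big rz0.
set M := class S A e x0.
have ZM z : z \in Z -> z \in M by rewrite inE => /andP[].
have MA z : z \in M -> z \in A by rewrite inE => /andP[].
have MS z : z \in M -> z \notin S by rewrite inE => /and3P[].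
have Mt y s : y \in M -> s \in S -> s \in A -> e s y = e s x0.
  rewrite inE => /and3P[_ _ /forall_inP H] sS sA.
  by apply/esym/eqP/H; rewrite inE sS.
have Zdeg z : z \in Z -> (k < #|[set y in M | e y z]|) /\ (k < #|[set y in M | e z y]|).
  by rewrite inE => /and3P[].
clearbody M; have ZA z : z \in Z -> z \in A by move/ZM/MA.
have rz z : z \in Z -> rank Z z < m by apply: rank_max.
clearbody Z; set e' := rewired e Z k.
have rz' z : z \in Z :\ z0 -> rank Z z < m.-1.
  rewrite !inE => /andP[zz0 zZ]; have := rz z zZ.
  have : rank Z z != rank Z z0 by apply: contra_neq zz0; apply: rank_inj.
  by rewrite rz0; goal_lia.
have cardZ' (P : pred nat) : #|[set z in Z :\ z0 | P (rank Z z)]| = count P (iota 0 m.-1).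
  have -> : #|[set z in Z :\ z0 | P (rank Z z)]| =
      #|[set z in Z | P (rank Z z) && (rank Z z != m.-1)]|.
    apply: eq_card => z; rewrite !inE; case zZ: (z \in Z); rewrite ?andbF //= andbT andbC.
    congr (_ && _); congr (~~ _); apply/eqP/eqP => [->//|E].
    by apply: (rank_inj zZ z0Z); rewrite rz0 E.
  rewrite (card_rank Z (fun r => P r && (r != m.-1))) -/m.
  have -> : iota 0 m = iota 0 m.-1 ++ [:: m.-1].
    by rewrite -[in LHS](prednK (n := m)) ?(leq_ltn_trans _ big) // -addn1 iotaD.
  rewrite count_cat /= eqxx andbF /= !addn0; apply: eq_in_count => r.
  by rewrite mem_iota add0n => /andP[_ lt]; rewrite ltn_eqF ?andbT.
have eW : {in A :\: Z &, e =2 e'}.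
  move=> x y; rewrite !inE => /andP[xZ _] /andP[yZ _].
  by rewrite /e' /rewired (negPf xZ) (negPf yZ).
have eZ x y : x \in Z -> y \in Z -> e' x y = cyclic_arc k (rank Z x) (rank Z y).
  by move=> xZ yZ; rewrite /e' /rewired xZ yZ.
have eZW z x : z \in Z -> x \notin Z -> e' z x = (rank Z z < reduced_indegree e Z k x).
  by move=> zZ xZ; rewrite /e' /rewired zZ (negPf xZ).
have eWZ z x : z \in Z -> x \notin Z -> e' x z = ~~ (rank Z z < reduced_indegree e Z k x).
  by move=> zZ xZ; rewrite /e' /rewired zZ (negPf xZ).
have tour' : tournament_on (A :\ z0) e'.
  split=> [x|x y]; rewrite !inE.
    case/andP => _ xA; case xZ: (x \in Z).
      by rewrite eZ // /cyclic_arc ltnn; case: ifP => //; case: ifP => //; goal_lia.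
    by rewrite -eW ?irr // !inE xZ xA.
  move=> /andP[_ xA] /andP[_ yA] xy; case xZ: (x \in Z); case yZ: (y \in Z).
  - rewrite !eZ // /cyclic_arc.
    have : rank Z x != rank Z y by apply: contra_neq xy; apply: rank_inj.
    move: (rank Z x) (rank Z y) => a b; clear.
    by case: ifP => h1; case: ifP => h2; do ?case: ifP => ?; lia.
  - by rewrite eZW ?eWZ ?yZ // negbK.
  - by rewrite (eWZ y x) ?(eZW y x) ?xZ.
  by rewrite -!eW ?inE ?xZ ?yZ ?xA ?yA // tot.
split=> //.
have n_le x : #|[set z in Z | e z x]| <= m.
  by apply: subset_leq_card; apply/subsetP => z; rewrite inE => /andP[].
have cnt_out x : x \in A -> x \notin Z -> #|[set z in Z :\ z0 | e' z x]| =
    minn (reduced_indegree e Z k x) m.-1.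
  move=> xA xZ; rewrite -count_iota_lt -cardZ'; apply: eq_card => z; rewrite !inE.
  by case: eqP => //= _; case zZ: (z \in Z); rewrite //= eZW.
have cnt_in x : x \in A -> x \notin Z -> #|[set z in Z :\ z0 | e' x z]| =
    m.-1 - reduced_indegree e Z k x.
  move=> xA xZ.
  have -> : #|[set z in Z :\ z0 | e' x z]| =
      count (fun r => ~~ (r < reduced_indegree e Z k x)) (iota 0 m.-1).
    rewrite -cardZ'; apply: eq_card => z; rewrite !inE.
    by case: eqP => //= _; case zZ: (z \in Z); rewrite //= eWZ.
  have := count_predC (fun r => r < reduced_indegree e Z k x) (iota 0 m.-1).
  rewrite count_iota_lt size_iota /predC /=.
  by move: (count _ _) => c; goal_lia.
have cnt_in0 x : x \in A -> x \notin Z -> #|[set z in Z | e x z]| =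
    m - #|[set z in Z | e z x]|.
  move=> xA xZ; rewrite /m -(cardsID [set z | e z x] Z).
  have -> : Z :&: [set z | e z x] = [set z in Z | e z x] by apply/setP => z; rewrite !inE.
  rewrite addKn; apply: eq_card => z; rewrite !inE.
  case zZ: (z \in Z); rewrite ?andbF ?andbT //=.
  have xz : x != z by apply: contraNneq xZ => ->.
  by rewrite (tot x z xA (ZA _ zZ) xz).
have outeq x : x \in A :\: Z -> minn k.+1 #|[set z in Z | e z x]| =
    minn k.+1 #|[set z in Z :\ z0 | e' z x]|.
  rewrite inE => /andP[xZ xA]; rewrite cnt_out // /reduced_indegree.
  have := n_le x; move: big; move: #|[set z in Z | _]| => n; case: ifP; goal_lia.
have ineq x : x \in A :\: Z -> minn k.+1 #|[set z in Z | e x z]| =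
    minn k.+1 #|[set z in Z :\ z0 | e' x z]|.
  rewrite inE => /andP[xZ xA]; rewrite cnt_in // cnt_in0 // /reduced_indegree.
  have := n_le x; move: big; move: #|[set z in Z | _]| => n; case: ifP; goal_lia.
have EA : A = (A :\: Z) :|: Z.
  by apply/setP => x; rewrite !inE; case: (boolP (x \in Z)) => [/ZA ->|_]; rewrite ?orbF.
have EA' : A :\ z0 = (A :\: Z) :|: (Z :\ z0).
  apply/setP => x; rewrite !inE; case: (eqVneq x z0) => [->|_] /=.
    by rewrite z0Z.
  by case: (boolP (x \in Z)) => [/ZA ->|_]; rewrite ?orbF.
have dis1 : [disjoint A :\: Z & Z].
  by apply/pred0P => x /=; rewrite inE; case: (x \in Z); rewrite ?andbF.
have dis2 : [disjoint A :\: Z & Z :\ z0].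
  by apply/pred0P => x /=; rewrite !inE; case: (x \in Z); rewrite ?andbF.
have m1 : 3 * k + 3 <= m.-1 by move: big; goal_lia.
split.
  rewrite {1}EA EA'; apply: (@solvable_exchange _ _ _ _ _ M _ _ _ (fun s => e s x0) z0) => //.
  - by rewrite -EA.
  - by move=> z /ZM /MS.
  - by move=> z; rewrite inE => /andP[_ /ZM /MS].
  - by apply/subsetP.
  - by rewrite -EA; apply/subsetP.
  - by move=> y s yM sS; rewrite inE => /andP[_ sA]; apply: Mt.
  - by move=> z /Zdeg [].
  - by move=> z /Zdeg [].
(* For the converse the degree condition must hold in the new tournament; the cyclic arcs on at
   least [3 k + 3] ranks supply it within the new core alone. *)
rewrite {2}EA EA'.
have [z1 z1Z] : exists z1, z1 \in Z :\ z0.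
  apply/set0Pn; rewrite -card_gt0; have := cardZ' xpredT.
  rewrite count_predT size_iota; have -> : [set z in Z :\ z0 | true] = Z :\ z0.
    by apply/setP => z; rewrite !inE andbT.
  by move=> ->; move: m1; goal_lia.
have Z'M z : z \in Z :\ z0 -> z \in M :\ z0.
  by rewrite !inE => /andP[-> /ZM].
have deg' (P : pred nat) (b : rel 'I_N) z : z \in Z :\ z0 ->
    (forall y, y \in Z :\ z0 -> b y z = P (rank Z y)) ->
    count P (iota 0 m.-1) <= #|[set y in M :\ z0 | b y z]|.
  move=> zZ Hb; rewrite -cardZ'; apply: subset_leq_card; apply/subsetP => y.
  by rewrite inE => /andP[yZ Py]; rewrite inE Z'M // Hb.
apply: (@solvable_exchange _ _ _ _ _ (M :\ z0) _ _ _ (fun s => e s x0) z1) => //.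
- by rewrite -EA'.
- by move=> z; rewrite inE => /andP[_ /ZM /MS].
- by move=> z /ZM /MS.
- by move=> x y xW yW; rewrite eW.
- by apply/subsetP.
- by rewrite -EA'; apply/subsetP => z; rewrite !inE => /andP[-> /MA].
- by move=> y; rewrite inE => /andP[_ /MS].
- move=> y s; rewrite inE => /andP[yz0 yM] sS; rewrite inE => /andP[sZ sA].
  case yZ: (y \in Z); last first.
    by rewrite -eW ?Mt // inE ?sZ ?sA ?yZ ?MA.
  have yZ' : y \in Z :\ z0 by rewrite inE yz0.
  rewrite eWZ // /reduced_indegree.
  have zs z : z \in Z -> z != s by move=> zZ; apply: contraNneq sZ => <-.
  (* A terminal dominates all of [Z] or none of it. The indegree [0] stays [0] and [m] becomes
     [m - 1], so its direction towards the surviving core is preserved. *)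
  have -> : #|[set z in Z | e z s]| = if e s x0 then 0 else m.
    case es: (e s x0).
      apply/eqP; rewrite cards_eq0; apply/eqP/setP => z; rewrite !inE.
      case zZ: (z \in Z) => //=; rewrite (tot z s) ?(ZA z) ?zs // (Mt z) ?es //.
      exact: ZM.
    apply: eq_card => z; rewrite !inE; case zZ: (z \in Z) => //=.
    by rewrite (tot z s) ?(ZA z) ?zs // (Mt z) ?es //; apply: ZM.
  case: (e s x0); first by [].
  by have := rz' y yZ'; case: ifP => _; move: big; goal_lia.
- move=> z zZ; apply: leq_trans (deg' (fun t => cyclic_arc k t (rank Z z)) e' z zZ _).
    have := rz' z zZ; move: (rank Z z) m1 => r; move: m.-1 => m' m1 rm'.
    (* Low ranks are dominated by the high block, high ranks by the middle block and middle ranks by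
       the low block, each of at least [k + 1] ranks. *)
    case: (leqP r k) => r1; last case: (leqP k.*2.+2 r) => r2.
    + apply: leq_trans (count_iota_ge (a := k.*2.+2) (b := m') _ _); first by move: m1; goal_lia.
        by move: m1; goal_lia.
      move=> t /andP[t1 t2]; rewrite /cyclic_arc r1 t1 /=.
      by case: ifP => //; move: t1; goal_lia.
    + apply: leq_trans (count_iota_ge (a := k.+1) (b := k.*2.+2) _ _); first by goal_lia.
        by move: m1; goal_lia.
      move=> t /andP[t1 t2]; rewrite /cyclic_arc.
      by case: ifP; [|case: ifP => //]; move: t1 t2 r1 r2; goal_lia.
    + apply: leq_trans (count_iota_ge (a := 0) (b := k.+1) _ _); first by goal_lia.
        by move: m1; goal_lia.
      move=> t /andP[t1 t2]; rewrite /cyclic_arc.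
      by case: ifP; [|case: ifP => //]; move: t1 t2 r1 r2; goal_lia.
  by move=> y; rewrite inE => /andP[_ yZ]; move: zZ; rewrite inE => /andP[_ zZ]; rewrite eZ.
- move=> z zZ; apply: leq_trans (deg' (fun t => cyclic_arc k (rank Z z) t) (fun a b => e' b a) z zZ _).
    have := rz' z zZ; move: (rank Z z) m1 => r; move: m.-1 => m' m1 rm'.
    case: (leqP r k) => r1; last case: (leqP k.*2.+2 r) => r2.
    + apply: leq_trans (count_iota_ge (a := k.+1) (b := k.*2.+2) _ _); first by goal_lia.
        by move: m1; goal_lia.
      move=> t /andP[t1 t2]; rewrite /cyclic_arc.
      by case: ifP; [|case: ifP => //]; move: t1 t2 r1; goal_lia.
    + apply: leq_trans (count_iota_ge (a := 0) (b := k.+1) _ _); first by goal_lia.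
        by move: m1; goal_lia.
      move=> t /andP[t1 t2]; rewrite /cyclic_arc.
      by case: ifP; [|case: ifP => //]; move: t1 t2 r1 r2; goal_lia.
    + apply: leq_trans (count_iota_ge (a := k.*2.+2) (b := m') _ _); first by move: m1; goal_lia.
        by move: m1; goal_lia.
      move=> t /andP[t1 t2]; rewrite /cyclic_arc.
      by case: ifP; [|case: ifP => //]; move: t1 t2 r1 r2; goal_lia.
  by move=> y; rewrite inE => /andP[_ yZ]; move: zZ; rewrite inE => /andP[_ zZ]; rewrite eZ.
- by move=> x xW; rewrite outeq.
- by move=> x xW; rewrite ineq.
Qed.

End ClassRule.

(** * From cycles to levels *)

Section LevelsOfCycles.
Variables (V : finType) (S : {set V}).

(** A closed walk through [s] need not be simple, as an [S_cycle] must be; the way back from the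
    successor of [s] is therefore shortened, and still ends in [s]. *)
Lemma mutual_connect_S_cycle (e : rel V) s x : s \in S -> x != s ->
  connect e s x -> connect e x s -> exists c, S_cycle e S c.
Proof.
move=> sS xs /connectP [[|y p] /= ]; first by move=> _ E; rewrite E eqxx in xs.
move=> /andP[esy pth] Ex csx.
have /connectP [q] : connect e y s.
  by apply: connect_trans csx; apply/connectP; exists p.
case/shortenP => q' pq' uq' _ Es; exists (y :: q'); apply/and3P; split=> //.
  by rewrite /cycle rcons_path pq' -Es.
by apply/hasP; exists s => //; rewrite Es mem_last.
Qed.

(** The levels are the strongly connected components: [anc x] determines the component and grows
    along arcs. [h] orders by [#|anc x|] first, and the rank of [anc x] among all sets breaks ties
    between different components. *)
Lemma S_cycle_free_levels (e : rel V) : (forall c, ~~ S_cycle e S c) ->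
  exists2 h : V -> nat, separated S setT h & forall x y, e x y -> h x <= h y.
Proof.
move=> acyc; pose anc x := [set y | connect e y x].
pose h x := #|anc x| * #|{set V}| + enum_rank (anc x).
have h_inj x y : h x = h y -> anc x = anc y.
  move=> E; apply: enum_rank_inj; apply: val_inj.
  move: E (ltn_ord (enum_rank (anc x))) (ltn_ord (enum_rank (anc y))); rewrite /h /=.
  move=> E lt1 lt2; have := congr1 (modn^~ #|{set V}|) E.
  by rewrite /= !modnMDl !modn_small.
exists h.
  move=> s x sS _ _ xs; apply/negP => /eqP/h_inj E.
  have c1 : connect e x s.
    by move/setP/(_ x): E; rewrite !inE connect0 => <-.
  have c2 : connect e s x by move/setP/(_ s): E; rewrite !inE connect0 => ->.
  by have [c] := mutual_connect_S_cycle sS xs c2 c1; rewrite (negPf (acyc c)).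
move=> x y exy.
have sub : anc x \subset anc y.
  apply/subsetP => z; rewrite !inE => /connect_trans; apply; exact: connect1.
case: (eqVneq (anc x) (anc y)) => [|ne]; first by rewrite /h => ->.
have lt : #|anc x| < #|anc y| by apply: proper_card; rewrite properEneq ne.
rewrite /h; apply: leq_trans (leq_addr _ _).
apply: leq_trans (leq_mul lt (leqnn _)); rewrite mulSn addnC leq_add2r.
exact/ltnW/ltn_ord.
Qed.

(** Around a cycle the levels never fall, so they are constant, which a terminal on a cycle with a
    second vertex excludes; irreflexivity excludes loops. *)
Lemma levels_S_cycle_free (e : rel V) (h : V -> nat) :
  (forall x, ~~ e x x) -> separated S setT h -> (forall x y, e x y -> h x <= h y) ->
  forall c, ~~ S_cycle e S c.
Proof.
move=> irr sep mono c; apply/negP => /and3P[cyc _ /hasP [s sc sS]].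
case: (rot_to sc) => i p Ep.
have : cycle e (s :: p) by rewrite -Ep rot_cycle.
case: p {Ep} => [|y p] /=; first by rewrite (negPf (irr s)).
case/andP => esy pth.
have le1 := mono _ _ esy.
have le2 : h y <= h s.
  elim: p y pth {esy le1} => [|z p IH] y /=; first by rewrite andbT; apply: mono.
  by case/andP => /mono le /IH; apply: leq_trans.
have ys : y != s by apply: contraTneq esy => ->.
by have := sep s y sS (in_setT _) (in_setT _) ys; rewrite eqn_leq le1 le2.
Qed.

Lemma solvable_bij (T : finType) (f : T -> V) (A : {set V}) (e : rel V) k :
  injective f -> (forall x, (x \in A) = (x \in codom f)) ->
  solvable (f @^-1: S) setT (fun i j => e (f i) (f j)) k <-> solvable S A e k.
Proof.
move=> f_inj fA.
have fAi i : f i \in A by rewrite fA codom_f.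
have E (h : V -> nat) (h' : T -> nat) : (forall i, h (f i) = h' i) ->
  #|back_arcs A e h| = #|back_arcs setT (fun i j => e (f i) (f j)) h'|.
  move=> hh'; pose F (p : T * T) := (f p.1, f p.2).
  rewrite -(card_imset (f := F)); last by move=> [a b] [c d] [/f_inj -> /f_inj ->].
  apply: eq_card => -[x y]; apply/idP/imsetP.
    rewrite inE /= !fA => /and4P[/codomP [i ->] /codomP [j ->]]; rewrite !hh' => eij lt.
    by exists (i, j) => //; rewrite !inE /= eij.
  by case=> -[i j]; rewrite !inE /= => /andP[eij lt] [-> ->]; rewrite !fAi !hh' eij.
split=> -[h sep le_k].
  pose h' x := if [pick i | f i == x] is Some i then h i else 0.
  have hh' i : h' (f i) = h i.
    by rewrite /h'; case: pickP => [j /eqP/f_inj ->//|/(_ i)]; rewrite eqxx.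
  exists h'; last by rewrite (E _ _ hh').
  move=> s x sS; rewrite !fA => /codomP [i Es] /codomP [j ->]; rewrite Es !hh'.
  by rewrite (inj_eq f_inj); apply: sep; rewrite ?inE -?Es.
exists (fun i => h (f i)); last by rewrite -(E h).
move=> s x; rewrite inE => sS _ _ xs; apply: sep => //.
by rewrite (inj_eq f_inj).
Qed.

End LevelsOfCycles.

Lemma yes_solvable I :
  yes_instance I <-> solvable (terminals I) setT (@Defs.arc I) (budget I).
Proof.
have [irr tot] := arc_tournament I.
split=> [[F [sF le_k acyc]]|[h sep le_k]].
  have [h sep mono] := S_cycle_free_levels acyc; exists h => //.
  apply: leq_trans le_k; apply: subset_leq_card; apply/subsetP => -[x y].
  rewrite !inE /= => /andP[exy lt]; apply: contraTT lt => nF.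
  by rewrite -leqNgt; apply: mono; rewrite /del_arcs exy.
exists (back_arcs setT (@Defs.arc I) h); split=> //.
  by apply/subsetP => -[x y]; rewrite !inE /= => /andP[].
apply: (levels_S_cycle_free (h := h)) => // [x|x y]; first by rewrite /del_arcs irr.
by rewrite /del_arcs !inE /= => /andP[->] /=; rewrite -leqNgt.
Qed.

(** * The instance on the surviving vertices *)

Section Induced.
Variables (N : nat) (S A : {set 'I_N}) (e : rel 'I_N) (k : nat).
Hypothesis tour : tournament_on A e.

Definition induced_arc : rel 'I_#|A| := fun i j => e (enum_val i) (enum_val j).

Lemma induced_tournament : tournament induced_arc.
Proof.
case: tour => irr tot; split=> [i|i j ij].
  by apply/negbTE/irr/enum_valP.
rewrite /induced_arc tot ?enum_valP ?(inj_eq enum_val_inj) //.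
by case: (e _ _).
Qed.

Definition induced : instance :=
  Instance induced_tournament (enum_val @^-1: S) k.

Lemma yes_induced : yes_instance induced <-> solvable S A e k.
Proof.
rewrite yes_solvable; apply: solvable_bij; first exact: enum_val_inj.
move=> x; apply/idP/codomP => [xA|[i ->]]; last exact: enum_valP.
by exists (enum_rank_in xA x); rewrite enum_rankK_in.
Qed.

(** In this form the output is a scan of the original vertices that skips those outside [A]; the
    program never has to renumber anything. *)
Lemma encode_induced : encode induced =
  [:: #|A|, k & [seq nat_of_bool (x \in S) | x <- enum A] ++
                [seq nat_of_bool (e x y) | x <- enum A, y <- enum A]].
Proof.
have E : [seq enum_val i | i <- enum 'I_#|A|] = enum A.
  case: (set_0Vmem A) => [A0|[x0 x0A]].
    have E0 : enum A = [::] by rewrite A0 enum_set0.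
    by rewrite E0; apply: size0nil; rewrite size_map size_enum_ord cardE E0.
  rewrite -[RHS](mkseq_nth x0) -cardE /mkseq -val_enum_ord -map_comp.
  by apply: eq_map => i; rewrite /= (enum_val_nth x0).
rewrite /encode /=; congr [:: _, _ & _ ++ _].
  by rewrite -E -[RHS]map_comp; apply: eq_map => i; rewrite /= inE.
rewrite -E /allpairs_dep -[in RHS]map_comp; congr flatten; apply: eq_map => i.
by rewrite /= -[RHS]map_comp.
Qed.

End Induced.

(** * Compiling expressions to the random access machine *)

(** [n.+1] keeps the bound positive at [n = 0], and is itself at most the input size when [n] is the
    number of vertices. *)
Definition poly_bounded (f : nat -> nat) : Prop :=
  exists c d, forall n, f n <= c * n.+1 ^ d.

Lemma poly_bounded_const c : poly_bounded (fun=> c).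
Proof. by exists c, 0 => n; rewrite expn0 muln1. Qed.

Lemma poly_bounded_id : poly_bounded id.
Proof. by exists 1, 1 => n; rewrite expn1 mul1n. Qed.

Lemma poly_bounded_add f g :
  poly_bounded f -> poly_bounded g -> poly_bounded (fun n => f n + g n).
Proof.
move=> [c [d Hf]] [c' [d' Hg]]; exists (c + c'), (d + d') => n.
rewrite mulnDl; apply: leq_add.
  apply: leq_trans (Hf n) _; rewrite leq_mul2l leq_pexp2l ?orbT //; lia.
apply: leq_trans (Hg n) _; rewrite leq_mul2l leq_pexp2l ?orbT //; lia.
Qed.

Lemma poly_bounded_mul f g :
  poly_bounded f -> poly_bounded g -> poly_bounded (fun n => f n * g n).
Proof.
move=> [c [d Hf]] [c' [d' Hg]]; exists (c * c'), (d + d') => n.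
by rewrite expnD mulnACA leq_mul.
Qed.

(** A total-correctness triple with a time budget; [b] is only an upper bound, so the costs below
    are rounded up generously. *)
Definition runs p s (b : nat) (Q : state -> Prop) : Prop :=
  exists t s', [/\ exec p s t s', t <= b & Q s'].

Lemma runs_weaken p s b b' (Q Q' : state -> Prop) :
  runs p s b Q -> b <= b' -> (forall s', Q s' -> Q' s') -> runs p s b' Q'.
Proof.
by move=> [t [s' [ex le q]]] le' QQ'; exists t, s'; split=> //; [lia|apply: QQ'].
Qed.

Lemma runs_skip s (Q : state -> Prop) : Q s -> runs Skip s 1 Q.
Proof. by move=> q; exists 1, s; split=> //; constructor. Qed.

Lemma runs_set r e s (Q : state -> Prop) :
  Q (State (update (regs s) r (eval s e)) (memory s)) ->
  runs (Set_reg r e) s (ecost e).+1 Q.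
Proof. by move=> q; do 2!eexists; split; [constructor| |exact: q]. Qed.

Lemma runs_store a e s (Q : state -> Prop) :
  Q (State (regs s) (update (memory s) (eval s a) (eval s e))) ->
  runs (Store a e) s (ecost a + ecost e).+1 Q.
Proof. by move=> q; do 2!eexists; split; [constructor| |exact: q]. Qed.

Lemma runs_seq p q s b b' (Q R : state -> Prop) :
  runs p s b Q -> (forall s', Q s' -> runs q s' b' R) -> runs (Seq p q) s (b + b').+1 R.
Proof.
move=> [t [s' [ex le qs]]] /(_ s' qs) [t' [s'' [ex' le' r]]].
exists (t + t').+1, s''; split=> //; [exact: ExecSeq ex ex'|lia].
Qed.

Lemma runs_if e p q s b b' (Q : state -> Prop) :
  (eval s e != 0 -> runs p s b Q) -> (eval s e = 0 -> runs q s b' Q) ->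
  runs (If e p q) s (ecost e + (b + b')).+1 Q.
Proof.
case: (eqVneq (eval s e) 0) => [E _ /(_ E)|E /(_ isT) + _].
  move=> [t [s' [ex le qs]]]; exists (ecost e + t).+1, s'; split=> //; last lia.
  exact: ExecIfF.
move=> [t [s' [ex le qs]]]; exists (ecost e + t).+1, s'; split=> //; last lia.
exact: ExecIfT.
Qed.

Lemma runs_while e p b n (Inv : nat -> state -> Prop) s :
  (forall i s, i < n -> Inv i s -> eval s e != 0 /\ runs p s b (Inv i.+1)) ->
  (forall s, Inv n s -> eval s e = 0) -> Inv 0 s ->
  runs (While e p) s ((ecost e + b).+1 * n + (ecost e).+1) (Inv n).
Proof.
move=> step stop I0; rewrite -(subn0 n).
have H j i s' : n - i = j -> i <= n -> Inv i s' ->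
    runs (While e p) s' ((ecost e + b).+1 * j + (ecost e).+1) (Inv n).
  elim: j i s' => [|j IH] i s' Ej le_in Is.
    have Ei : i = n by lia.
    exists (ecost e).+1, s'; split; [|lia|by rewrite -Ei].
    by apply: ExecWhileF; apply: stop; rewrite -Ei.
  have lt : i < n by lia.
  have [ne [t [s1 [ex le Is']]]] := step i s' lt Is.
  have [t' [s2 [ex' le' Is'']]] := IH i.+1 s1 ltac:(lia) lt Is'.
  exists (ecost e + t + t').+1, s2; split=> //; first exact: ExecWhileT ex ex'.
  rewrite mulnS; lia.
by rewrite {2}subn0; apply: (H _ 0).
Qed.

Lemma runs_set_seq r e q s b (Q : state -> Prop) :
  runs q (State (update (regs s) r (eval s e)) (memory s)) b Q ->
  runs (Seq (Set_reg r e) q) s ((ecost e).+1 + b).+1 Q.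
Proof.
move=> H; apply: (runs_seq (Q := fun s' => s' = _)) => [|s' ->]; last exact: H.
exact: runs_set.
Qed.

Lemma runs_store_seq a e q s b (Q : state -> Prop) :
  runs q (State (regs s) (update (memory s) (eval s a) (eval s e))) b Q ->
  runs (Seq (Store a e) q) s ((ecost a + ecost e).+1 + b).+1 Q.
Proof.
move=> H; apply: (runs_seq (Q := fun s' => s' = _)) => [|s' ->]; last exact: H.
exact: runs_store.
Qed.

Definition for_loop (r : nat) (bnd : expr) (p : prog) : prog :=
  Seq (Set_reg r (Const 0))
      (While (Defs.Sub bnd (Reg r)) (Seq p (Set_reg r (Add (Reg r) (Const 1))))).

Definition for_cost (c b n : nat) : nat := ((c + b + 8) * n + c + 8).

Lemma runs_for r bnd p b n (Inv : nat -> state -> Prop) s :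
  Inv 0 (State (update (regs s) r 0) (memory s)) ->
  (forall i s, Inv i s -> eval s bnd = n /\ regs s r = i) ->
  (forall i s, i < n -> Inv i s -> runs p s b (fun s' =>
     Inv i.+1 (State (update (regs s') r (regs s' r).+1) (memory s')))) ->
  runs (for_loop r bnd p) s (for_cost (ecost bnd) b n) (Inv n).
Proof.
move=> I0 Ib step.
apply: runs_weaken (runs_seq (b := 2) (b' := for_cost (ecost bnd) b n - 3) (Q := Inv 0) _ _) _ (fun s x => x);
  last by rewrite /for_cost; lia.
  exact: runs_set.
move=> {I0}s I0.
apply: runs_weaken (runs_while (b := (b + 4).+1) (Inv := Inv) (n := n) _ _ I0) _ (fun s x => x).
- move=> i {I0}s lt Is; have [Eb Er] := Ib _ _ Is; split; first by rewrite /= Eb Er; lia.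
  apply: runs_seq (step _ _ lt Is) _ => s' H; apply: runs_set.
  by rewrite /= addn1.
- by move=> s' /Ib /= [-> ->]; rewrite subnn.
- by rewrite /for_cost /=; nia.
Qed.

(** The only iteration is [Sum], over the [N] vertices. The budget [Par] may enter sums and
    comparisons, but never the length of a loop, as it can be exponential in the input size. *)
Inductive ex : Type :=
  | Cst of nat
  | Siz
  | Par
  | Var of nat
  | Plus of ex & ex
  | Minus of ex & ex
  | Get of nat & ex & ex
  | Ite of ex & ex & ex
  | Sum of nat & ex
  | Let of nat & ex & ex.

(* Memory from address 2 on is a sequence of arrays of [N + 1] rows of length
   [N]; in array 0 the input provides the terminals as row 0 and the adjacency
   matrix as the other rows. *)
Definition addr (N a i j : nat) : nat := 2 + a * (N * N + N) + i * N + j.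

Fixpoint ev (N k : nat) (mem : nat -> nat) (env : nat -> nat) (e : ex) : nat :=
  match e with
  | Cst n => n
  | Siz => N
  | Par => k
  | Var x => env x
  | Plus a b => ev N k mem env a + ev N k mem env b
  | Minus a b => ev N k mem env a - ev N k mem env b
  | Get a i j =>
      if (ev N k mem env i <= N) && (ev N k mem env j < N)
      then mem (addr N a (ev N k mem env i) (ev N k mem env j)) else 0
  | Ite c a b => if ev N k mem env c == 0 then ev N k mem env b else ev N k mem env a
  | Sum x a => \sum_(i < N) ev N k mem (update env x i) a
  | Let x a b => ev N k mem (update env x (ev N k mem env a)) b
  end.

Lemma ev_eq_env N k mem env env' e : env =1 env' -> ev N k mem env e = ev N k mem env' e.
Proof.
move=> He; elim: e env env' He => //=.
- by move=> p IHp q IHq env env' He; rewrite (IHp _ _ He) (IHq _ _ He).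
- by move=> p IHp q IHq env env' He; rewrite (IHp _ _ He) (IHq _ _ He).
- by move=> b p IHp q IHq env env' He; rewrite (IHp _ _ He) (IHq _ _ He).
- by move=> p IHp q IHq r IHr env env' He; rewrite (IHp _ _ He) (IHq _ _ He) (IHr _ _ He).
- move=> x p IHp env env' He; apply: eq_bigr => i _; apply: IHp => y.
  by rewrite /update He.
- move=> x p IHp q IHq env env' He; rewrite (IHp _ _ He); apply: IHq => y.
  by rewrite /update He.
Qed.

(* Register 0 holds [N], register 1 the budget, register 2 the array size
   [N * N + N]; 3 and 4 are scratch, 5 and 6 are left to the main program. *)
Definition vreg x := x.*2 + 10.
Definition treg d := d.*2 + 11.

(** The registers that code compiled at depth [d] must preserve: all variables (even, from 10 on)
    and the temporaries (odd) of smaller depth, besides the low registers other than the scratch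
    ones. *)
Definition keep d r : bool :=
  [&& r != 3, r != 4 & [|| r < 10, ~~ odd r | r < treg d]].

Fixpoint times_size (a : nat) : expr :=
  if a is a'.+1 then Add (times_size a') (Reg 2) else Const 2.

(* Leaves the address of cell (i, j) of array [a] in register 3, for [i] in
   register [ri] and [j] in register [rj]. *)
Definition address a ri rj : prog :=
  Seq (Set_reg 3 (Add (times_size a) (Reg rj)))
 (Seq (Set_reg 4 (Reg ri))
      (While (Reg 4) (Seq (Set_reg 3 (Add (Reg 3) (Reg 0)))
                          (Set_reg 4 (Defs.Sub (Reg 4) (Const 1)))))).

Definition address_cost a n := 45 + 4 * a + 15 * n.

Ltac poly_bounded_tac := repeat first [ assumption | exact: poly_bounded_const
  | exact: poly_bounded_id | apply: poly_bounded_add | apply: poly_bounded_mul ].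

Lemma poly_bounded_address_cost a : poly_bounded (address_cost a).
Proof. by rewrite /address_cost; poly_bounded_tac. Qed.


(** A stack discipline: the value ends in [treg d], and only temporaries of depth at least [d] are
    touched. The binders save the old value of their variable in [treg d] and restore it, so that
    shadowing is harmless. *)
Fixpoint comp (d : nat) (e : ex) : prog :=
  match e with
  | Cst n => Set_reg (treg d) (Const n)
  | Siz => Set_reg (treg d) (Reg 0)
  | Par => Set_reg (treg d) (Reg 1)
  | Var x => Set_reg (treg d) (Reg (vreg x))
  | Plus a b => Seq (comp d a) (Seq (comp d.+1 b)
      (Set_reg (treg d) (Add (Reg (treg d)) (Reg (treg d.+1)))))
  | Minus a b => Seq (comp d a) (Seq (comp d.+1 b)
      (Set_reg (treg d) (Defs.Sub (Reg (treg d)) (Reg (treg d.+1)))))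
  | Get a i j => Seq (comp d i) (Seq (comp d.+1 j)
      (If (Defs.Sub (Add (Reg 0) (Const 1)) (Reg (treg d)))
         (If (Defs.Sub (Reg 0) (Reg (treg d.+1)))
            (Seq (address a (treg d) (treg d.+1)) (Set_reg (treg d) (Fetch (Reg 3))))
            (Set_reg (treg d) (Const 0)))
         (Set_reg (treg d) (Const 0))))
  | Ite c a b => Seq (comp d c) (If (Reg (treg d)) (comp d a) (comp d b))
  | Sum x a => Seq (Set_reg (treg d) (Reg (vreg x))) (Seq (Set_reg (treg d.+1) (Const 0))
      (Seq (for_loop (vreg x) (Reg 0) (Seq (comp d.+2 a)
              (Set_reg (treg d.+1) (Add (Reg (treg d.+1)) (Reg (treg d.+2))))))
      (Seq (Set_reg (vreg x) (Reg (treg d)))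
           (Set_reg (treg d) (Reg (treg d.+1))))))
  | Let x a b => Seq (Set_reg (treg d) (Reg (vreg x))) (Seq (comp d.+1 a)
      (Seq (Set_reg (vreg x) (Reg (treg d.+1))) (Seq (comp d.+1 b)
      (Seq (Set_reg (vreg x) (Reg (treg d)))
           (Set_reg (treg d) (Reg (treg d.+1)))))))
  end.

Fixpoint comp_cost (e : ex) (n : nat) : nat :=
  match e with
  | Cst _ | Siz | Par | Var _ => 2
  | Plus a b | Minus a b | Let _ a b => comp_cost a n + comp_cost b n + 20
  | Get a i j => comp_cost i n + comp_cost j n + address_cost a n + 30
  | Ite a b c => comp_cost a n + comp_cost b n + comp_cost c n + 20
  | Sum _ a => (comp_cost a n + 20) * n + 40
  end.

Lemma poly_bounded_comp_cost e : poly_bounded (comp_cost e).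
Proof.
elim: e => [n|||x|a Ha b Hb|a Ha b Hb|c a Ha b Hb|a Ha b Hb c Hc|x a Ha|x a Ha b Hb] /=;
  poly_bounded_tac.
Qed.

Definition ready N k s : Prop := [/\ regs s 0 = N, regs s 1 = k & regs s 2 = N * N + N].
Definition env_of s : nat -> nat := fun x => regs s (vreg x).

Lemma eval_times_size N a s : regs s 2 = N * N + N ->
  eval s (times_size a) = 2 + a * (N * N + N).
Proof. by move=> E; elim: a => //= a ->; rewrite E mulSn; lia. Qed.

Lemma ecost_times_size a : ecost (times_size a) = a.*2.+1.
Proof. by elim: a => //= a ->; lia. Qed.

Lemma runs_address N k a ri rj i j s : ready N k s ->
  regs s ri = i -> regs s rj = j -> ri != 3 -> i <= N ->
  runs (address a ri rj) s (address_cost a N) (fun s' =>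
    [/\ regs s' 3 = addr N a i j, memory s' = memory s &
        forall r, r != 3 -> r != 4 -> regs s' r = regs s r]).
Proof.
move=> [E0 E1 E2] Ei Ej ri3 iN; rewrite /address.
apply: runs_weaken (runs_seq (b := a.*2 + 4) (b' := address_cost a N - a.*2 - 5) _ _) _ (fun s x => x);
  last by rewrite /address_cost; lia.
  apply: runs_weaken (runs_set (Q := fun s' => [/\ regs s' 3 = 2 + a * (N * N + N) + j,
     memory s' = memory s & forall r, r != 3 -> regs s' r = regs s r]) _) _ (fun s x => x).
    split=> //=; first by rewrite /update eqxx (eval_times_size _ E2) Ej.
    by move=> r /negPf r3; rewrite /update r3.
  by rewrite /= ecost_times_size; lia.
move=> s1 [F3 Fm Fr].
apply: runs_weaken (runs_seq (b := 2) (b' := address_cost a N - a.*2 - 8)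
  (Q := fun s' => [/\ regs s' 3 = 2 + a * (N * N + N) + j, regs s' 4 = i,
     memory s' = memory s & forall r, r != 3 -> r != 4 -> regs s' r = regs s r])
     _ _) _ (fun s x => x);
  last by rewrite /address_cost; lia.
  apply: runs_set; split=> //=; first by rewrite /update eqxx Fr.
  by move=> r r3 /negPf r4; rewrite /update r4 Fr.
move=> s2 [G3 G4 Gm Gr].
apply: runs_weaken (runs_while (b := 9) (n := i) (Inv := fun t s' =>
  [/\ regs s' 3 = 2 + a * (N * N + N) + j + t * N, regs s' 4 = i - t,
     memory s' = memory s & forall r, r != 3 -> r != 4 -> regs s' r = regs s r]) _ _ _) _ _.
- move=> t s3 lt [H3 H4 Hm Hr]; split; first by rewrite /= H4; lia.
  apply: runs_set_seq; apply: runs_set.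
  split=> //=.
  + by rewrite /update /= H3 Hr // E0; lia.
  + by rewrite /update /= H4; lia.
  by move=> r /negPf r3 /negPf r4; rewrite /update r4 r3 Hr ?r3 ?r4.
- by move=> s3 [_ /= -> _ _]; rewrite subnn.
- by split=> //; rewrite ?subn0 ?mul0n ?addn0.
- by rewrite /address_cost /=; lia.
- by move=> s3 [H3 _ Hm Hr]; split=> //; rewrite H3 /addr; lia.
Qed.


Lemma keep_treg d d' : d < d' -> keep d' (treg d).
Proof. by rewrite /keep /treg; lia. Qed.

Lemma keep_vreg d x : keep d (vreg x).
Proof. by rewrite /keep /vreg; lia. Qed.

Lemma keep_small d r : r < 10 -> r != 3 -> r != 4 -> keep d r.
Proof. by rewrite /keep; lia. Qed.

Lemma keepW d d' r : d <= d' -> keep d r -> keep d' r.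
Proof. by rewrite /keep /treg; lia. Qed.

Lemma keep_neq_treg d d' r : d <= d' -> keep d r -> (r == treg d') = false.
Proof. by rewrite /keep /treg; lia. Qed.

Lemma ready_update N k s r x mem :
  ready N k s -> 2 < r -> ready N k (State (update (regs s) r x) mem).
Proof. by case=> E0 E1 E2 lt; split; rewrite /= /update ltn_eqF //; lia. Qed.

Lemma ready_keep N k s s' d : ready N k s ->
  (forall r, keep d r -> regs s' r = regs s r) -> ready N k s'.
Proof. by case=> E0 E1 E2 H; split; rewrite H. Qed.

Lemma env_of_update_treg s d x mem :
  env_of (State (update (regs s) (treg d) x) mem) =1 env_of s.
Proof. by move=> y; rewrite /env_of /= /update; case: eqP => //; rewrite /treg /vreg; lia. Qed.

Lemma env_of_update_vreg s x y mem :
  env_of (State (update (regs s) (vreg x) y) mem) =1 update (env_of s) x y.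
Proof.
move=> z; rewrite /env_of /= /update /vreg eqn_add2r.
by have -> : (z.*2 == x.*2) = (z == x) by lia.
Qed.

Lemma env_of_keep s s' d : (forall r, keep d r -> regs s' r = regs s r) ->
  env_of s' =1 env_of s.
Proof. by move=> H x; rewrite /env_of H // keep_vreg. Qed.

Definition comp_post N k d e s s' : Prop :=
  [/\ memory s' = memory s, regs s' (treg d) = ev N k (memory s) (env_of s) e &
      forall r, keep d r -> regs s' r = regs s r].

Lemma runs_comp e N k d s : ready N k s ->
  runs (comp d e) s (comp_cost e N) (comp_post N k d e s).
Proof.
have leaf c (x : expr) s' d' : ecost x = 1 ->
    eval s' x = ev N k (memory s') (env_of s') c ->
    runs (Set_reg (treg d') x) s' 2 (comp_post N k d' c s').
  move=> Ec Ev; have := @runs_set (treg d') x s' (comp_post N k d' c s').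
  rewrite Ec; apply; split=> //=; first by rewrite /update eqxx.
  by move=> r kr; rewrite /update (keep_neq_treg (leqnn _) kr).
have bin (op : expr -> expr -> expr) (f : nat -> nat -> nat) a b c s' d' :
    (forall x y, ecost (op x y) = (ecost x + ecost y).+1) ->
    (forall s x y, eval s (op x y) = f (eval s x) (eval s y)) ->
    (forall mem env, ev N k mem env c = f (ev N k mem env a) (ev N k mem env b)) ->
    (forall d s, ready N k s -> runs (comp d a) s (comp_cost a N) (comp_post N k d a s)) ->
    (forall d s, ready N k s -> runs (comp d b) s (comp_cost b N) (comp_post N k d b s)) ->
    ready N k s' ->
    runs (Seq (comp d' a) (Seq (comp d'.+1 b)
      (Set_reg (treg d') (op (Reg (treg d')) (Reg (treg d'.+1)))))) s'
      (comp_cost a N + comp_cost b N + 20) (comp_post N k d' c s').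
  move=> Hc Hop Hf Ha Hb rdy.
  apply: runs_weaken (runs_seq (b' := comp_cost b N + 5) (Ha d' s' rdy) _) _ (fun s x => x);
    last by lia.
  move=> s1 [m1 v1 k1]; have rdy1 := ready_keep rdy k1.
  apply: runs_weaken (runs_seq (b' := 4) (Hb d'.+1 s1 rdy1) _) _ (fun s x => x); last by lia.
  move=> s2 [m2 v2 k2].
  have := @runs_set (treg d') (op (Reg (treg d')) (Reg (treg d'.+1))) s2 (comp_post N k d' c s').
  rewrite Hc; apply; split=> /=; first by rewrite m2.
    rewrite /update eqxx Hop /= v2 (k2 (treg d')) ?keep_treg // v1 Hf m1; congr f.
    by apply: ev_eq_env; apply: env_of_keep k1.
  move=> r kr; rewrite /update (keep_neq_treg (leqnn _) kr) k2 ?k1 //.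
  exact: keepW kr.
elim: e d s => [n|||x|a Ha b Hb|a Ha b Hb|c a Ha b Hb|c Hc a Ha b Hb|x a Ha|x a Ha b Hb]
  d s rdy /=.
- exact: leaf.
- by apply: leaf => //=; case: rdy.
- by apply: leaf => //=; case: rdy.
- exact: leaf.
- exact: (bin Add addn).
- exact: (bin Defs.Sub subn).
- apply: runs_weaken (runs_seq (b' := comp_cost b N + address_cost c N + 28) (Ha d s rdy) _) _
    (fun s x => x); last by lia.
  move=> s1 [m1 v1 k1]; have rdy1 := ready_keep rdy k1.
  apply: runs_weaken (runs_seq (b' := address_cost c N + 25) (Hb d.+1 s1 rdy1) _) _ (fun s x => x);
    last by lia.
  move=> s2 [m2 v2 k2]; have rdy2 := ready_keep rdy1 k2.
  have E0 : regs s2 0 = N by case: rdy2.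
  have V1 : regs s2 (treg d) = ev N k (memory s) (env_of s) a by rewrite k2 ?keep_treg.
  have V2 : regs s2 (treg d.+1) = ev N k (memory s) (env_of s) b.
    by rewrite v2 m1; apply: ev_eq_env; apply: env_of_keep k1.
  have zero : ~~ ((regs s2 (treg d) <= N) && (regs s2 (treg d.+1) < N)) ->
      runs (Set_reg (treg d) (Const 0)) s2 2 (comp_post N k d (Get c a b) s).
    move=> out; apply: runs_set; split=> /=; first by rewrite m2.
      by rewrite /update eqxx -V1 -V2 (negPf out).
    move=> r kr; rewrite /update (keep_neq_treg (leqnn _) kr) k2 ?k1 //.
    exact: keepW kr.
  apply: runs_weaken (runs_if (b := address_cost c N + 15) (b' := 2) _ _) _ (fun s x => x);
    [|by move=> /= H; apply: zero; rewrite -E0; lia|by rewrite /=; lia].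
  move=> /= in1.
  apply: runs_weaken (runs_if (b := address_cost c N + 4) (b' := 2) _ _) _ (fun s x => x);
    [|by move=> /= H; apply: zero; rewrite -E0; lia|by rewrite /=; lia].
  move=> /= in2.
  have le1 : regs s2 (treg d) <= N by rewrite -E0; lia.
  have lt2 : regs s2 (treg d.+1) < N by rewrite -E0; lia.
  apply: runs_weaken (runs_seq (b' := 3) (runs_address c rdy2 (erefl _) (erefl _) _ le1) _) _
    (fun s x => x); [by rewrite /treg; lia| |by lia].
  move=> s3 [H3 m3 k3]; apply: runs_set; split=> /=; first by rewrite m3 m2.
    by rewrite /update eqxx H3 m3 m2 m1 -V1 -V2 le1 lt2.
  move=> r kr; rewrite /update (keep_neq_treg (leqnn _) kr) k3 ?k2 ?k1 //.
  - exact: keepW kr.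
  - by case/and3P: kr.
  - by case/and3P: kr.
- apply: runs_weaken (runs_seq (b' := comp_cost a N + comp_cost b N + 10) (Hc d s rdy) _) _
    (fun s x => x); last by lia.
  move=> s1 [m1 v1 k1]; have rdy1 := ready_keep rdy k1.
  apply: runs_weaken (runs_if (b := comp_cost a N) (b' := comp_cost b N) _ _) _ (fun s x => x);
    last by rewrite /=; lia.
    move=> /= ne; apply: runs_weaken (Ha d s1 rdy1) (leqnn _) _ => s2 [m2 v2 k2].
    split; [by rewrite m2| |by move=> r kr; rewrite k2 ?k1].
    rewrite v2 m1 /= -v1 (negPf ne); apply: ev_eq_env; exact: env_of_keep k1.
  move=> /= eq0; apply: runs_weaken (Hb d s1 rdy1) (leqnn _) _ => s2 [m2 v2 k2].
  split; [by rewrite m2| |by move=> r kr; rewrite k2 ?k1].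
  rewrite v2 m1 /= -v1 eq0 eqxx; apply: ev_eq_env; exact: env_of_keep k1.
- apply: runs_weaken (runs_set_seq (b := (comp_cost a N + 20) * N + 30) _) _ (fun s x => x);
    last by rewrite /=; lia.
  apply: runs_weaken (runs_set_seq (b := (comp_cost a N + 20) * N + 26) _) _ (fun s x => x);
    last by rewrite /=; lia.
  set s1 := State _ _.
  have T1 : regs s1 (treg d) = env_of s x.
    by rewrite /s1 /= /update eqxx /treg; case: eqP => //; lia.
  have T2 : regs s1 (treg d.+1) = 0 by rewrite /s1 /= /update eqxx.
  have K1 r : keep d r -> regs s1 r = regs s r.
    by move=> kr; rewrite /s1 /= /update !(keep_neq_treg _ kr).
  have M1 : memory s1 = memory s by [].
  clearbody s1.
  pose body := comp_cost a N + 5.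
  (* [treg d] holds the saved variable and [treg d.+1] the partial sum, which is why the summand is
     compiled at depth [d.+2]. *)
  pose Inv i s' := [/\ memory s' = memory s, regs s' (vreg x) = i,
     regs s' (treg d) = env_of s x,
     regs s' (treg d.+1) = \sum_(0 <= j < i) ev N k (memory s) (update (env_of s) x j) a &
     forall r, keep d r -> r != vreg x -> regs s' r = regs s r].
  have Irdy i s' : Inv i s' -> ready N k s'.
    case=> _ _ _ _ H; case: rdy => E0 E1 E2.
    by split; rewrite H // /vreg; lia.
  have nvt y z : (vreg y == treg z) = false by rewrite /vreg /treg; lia.
  have ntv y z : (treg y == vreg z) = false by rewrite /vreg /treg; lia.
  apply: runs_weaken (runs_seq (b := for_cost 1 body N) (b' := 5) (Q := Inv N) _ _) _
    (fun s x => x); last by rewrite /for_cost /body; nia.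
    apply: runs_for.
    + split; rewrite //= /update ?eqxx ?ntv ?T1 ?T2 ?big_geq //.
      by move=> r kr /negPf ->; apply: K1.
    + by move=> i s' H; have [E0 _ _] := Irdy _ _ H; case: H.
    + move=> i s' lt H; have rdy' := Irdy _ _ H; case: H => m' vx' td' td1' k'.
      apply: runs_weaken (runs_seq (b' := 4) (Ha d.+2 s' rdy') _) _ (fun s x => x);
        last by rewrite /body; lia.
      move=> s2 [m2 v2 k2]; apply: runs_set.
      have td12 : (treg d == treg d.+1) = false by rewrite /treg; lia.
      split=> /=.
      * by rewrite m2.
      * by rewrite /update eqxx nvt k2 ?keep_vreg // vx'.
      * by rewrite /update ntv td12 k2 ?keep_treg.
      * rewrite /update ntv eqxx k2 ?keep_treg // td1' v2 big_nat_recr //= m'.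
        congr (_ + _); apply: ev_eq_env => y; rewrite /env_of /update.
        case: eqP => [->//|/eqP ne]; rewrite k' ?keep_vreg //.
        by apply: contra ne; rewrite /vreg; lia.
      * move=> r kr ne; rewrite /update (negPf ne) (keep_neq_treg _ kr) // k2 ?k' //.
        exact: keepW (leqW (leqnSn d)) kr.
  move=> s2 [m2 vx2 td2 td12 k2].
  apply: (@runs_weaken _ _ (2 + 2).+1); last by move=> s' H; exact: H.
    apply: runs_set_seq; apply: runs_set; split=> //=.
      by rewrite /update eqxx ntv td12 big_mkord.
    move=> r kr; rewrite /update (keep_neq_treg (leqnn _) kr).
    by case: eqP => [->|/eqP ne]; [rewrite td2|rewrite k2].
  by [].
- have nvt y z : (vreg y == treg z) = false by rewrite /vreg /treg; lia.
  have ntv y z : (treg y == vreg z) = false by rewrite /vreg /treg; lia.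
  apply: runs_weaken (runs_set_seq (b := comp_cost a N + comp_cost b N + 16) _) _ (fun s x => x);
    last by rewrite /=; lia.
  set s0 := State _ _.
  have rdy0 : ready N k s0 by apply: ready_update; rewrite // /treg; lia.
  apply: runs_weaken (runs_seq (b' := comp_cost b N + 14) (Ha d.+1 s0 rdy0) _) _ (fun s x => x);
    last by lia.
  move=> s1 [m1 v1 k1]; have rdy1 := ready_keep rdy0 k1.
  apply: runs_weaken (runs_set_seq (b := comp_cost b N + 10) _) _ (fun s x => x);
    last by rewrite /=; lia.
  set s2 := State _ _.
  have rdy2 : ready N k s2 by apply: ready_update; rewrite // /vreg; lia.
  apply: runs_weaken (runs_seq (b' := 5) (Hb d.+1 s2 rdy2) _) _ (fun s x => x); last by lia.
  move=> s3 [m3 v3 k3].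
  apply: (@runs_weaken _ _ (2 + 2).+1); last by move=> s' H; exact: H.
    have td12 : (treg d == treg d.+1) = false by rewrite /treg; lia.
    have E0 : env_of s0 =1 env_of s by apply: env_of_update_treg.
    have E1 : env_of s1 =1 env_of s by move=> y; rewrite (env_of_keep k1) E0.
    have E2 : env_of s2 =1 update (env_of s) x (ev N k (memory s) (env_of s) a).
      move=> y; rewrite env_of_update_vreg /= v1 /= (ev_eq_env _ _ _ _ E0).
      by rewrite /update E1.
    apply: runs_set_seq; apply: runs_set; split=> /=.
    + by rewrite m3 /= m1.
    + by rewrite /update eqxx ntv v3 /= m1; apply: ev_eq_env.
    move=> r kr; rewrite /update (keep_neq_treg (leqnn _) kr); case: eqP => [->|/eqP ne].
      by rewrite k3 ?keep_treg // /= /update ntv k1 ?keep_treg // /= /update eqxx.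
    rewrite k3 ?(keepW _ kr) // /= /update (negPf ne) k1 ?(keepW _ kr) //= /update.
    by rewrite (keep_neq_treg (leqnn _) kr).
  by [].
Qed.

(** * Array and output commands *)

(** Addresses are mixed-radix numbers with digits [j < N], [i < N + 1] and leading part [a],
    recovered by division with remainder. *)
Lemma addr_inj N a i j b i' j' : i <= N -> j < N -> i' <= N -> j' < N ->
  addr N a i j = addr N b i' j' -> [/\ a = b, i = i' & j = j'].
Proof.
have E c x y : addr N c x y = 2 + ((c * N.+1 + x) * N + y) by rewrite /addr; nia.
rewrite !E => iN jN iN' jN' /addnI H.
have Hj := congr1 (modn^~ N) H; have Hd := congr1 (divn^~ N) H.
rewrite /= !modnMDl !modn_small // in Hj.
have N0 : 0 < N by lia.
rewrite /= !divnMDl // !divn_small // !addn0 in Hd.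
have Hi := congr1 (modn^~ N.+1) Hd; have Ha := congr1 (divn^~ N.+1) Hd.
rewrite /= !modnMDl !modn_small ?ltnS // in Hi.
by rewrite /= !divnMDl // !divn_small ?ltnS // !addn0 in Ha.
Qed.

Definition tab (a : nat) (e : ex) : prog :=
  for_loop (vreg 0) (Add (Reg 0) (Const 1)) (for_loop (vreg 1) (Reg 0)
    (Seq (comp 0 e) (Seq (address a (vreg 0) (vreg 1)) (Store (Reg 3) (Reg (treg 0)))))).

Definition tab_cost a e n : nat :=
  for_cost 3 (for_cost 1 (comp_cost e n + address_cost a n + 5) n) (n + 1).

Lemma poly_bounded_tab_cost a e : poly_bounded (tab_cost a e).
Proof.
have H1 := poly_bounded_comp_cost e; have H2 := poly_bounded_address_cost a.
by rewrite /tab_cost /for_cost; poly_bounded_tac.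
Qed.

Definition same_regs s s' : Prop :=
  forall r, r < 10 -> r != 3 -> r != 4 -> regs s' r = regs s r.

Lemma same_regs_trans s1 s2 s3 : same_regs s1 s2 -> same_regs s2 s3 -> same_regs s1 s3.
Proof. by move=> H1 H2 r *; rewrite H2 ?H1. Qed.

Lemma ready_same_regs N k s s' : same_regs s s' -> ready N k s -> ready N k s'.
Proof. by move=> H [E0 E1 E2]; split; rewrite H. Qed.

Lemma same_regs_vreg s s' x y :
  same_regs s s' -> same_regs s (State (update (regs s') (vreg x) y) (memory s')).
Proof. by move=> H r r10 *; rewrite /= /update ltn_eqF ?H // /vreg; lia. Qed.

Definition set_array N a (val : nat -> nat -> nat) (mem mem' : nat -> nat) : Prop :=
  forall b i j, i <= N -> j < N ->
    mem' (addr N b i j) = if b == a then val i j else mem (addr N b i j).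

(** The value of [e] must not depend on array [a], which is partly overwritten while [e] is
    evaluated; hence the hypothesis quantifies over all memories that agree elsewhere. *)
Lemma runs_tab N k a e (val : nat -> nat -> nat) s : ready N k s ->
  (forall mem env i j, i <= N -> j < N -> env 0 = i -> env 1 = j ->
     (forall b i' j', b != a -> i' <= N -> j' < N ->
        mem (addr N b i' j') = memory s (addr N b i' j')) ->
     ev N k mem env e = val i j) ->
  runs (tab a e) s (tab_cost a e N) (fun s' =>
    same_regs s s' /\ set_array N a val (memory s) (memory s')).
Proof.
move=> rdy Hval.
(* Exactly the cells before [(i, j)] in row-major order have been filled. *)
pose MI i j mem := forall b i' j', i' <= N -> j' < N -> mem (addr N b i' j') =
  if (b == a) && ((i' < i) || (i' == i) && (j' < j)) then val i' j'
  else memory s (addr N b i' j').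
pose Inv i s' := [/\ same_regs s s', regs s' (vreg 0) = i & MI i 0 (memory s')].
pose Inv2 i j s' := [/\ same_regs s s', regs s' (vreg 0) = i, regs s' (vreg 1) = j
  & MI i j (memory s')].
have v01 : (vreg 0 == vreg 1) = false by [].
apply: runs_weaken (runs_for (Inv := Inv) (n := N + 1)
  (b := for_cost 1 (comp_cost e N + address_cost a N + 5) N) _ _ _) _ _.
- split; rewrite /= ?/update ?eqxx //; first exact: same_regs_vreg.
  by move=> b i j iN jN; rewrite ltn0 andbF andbF.
- by move=> i s' [sr E M]; have [E0 _ _] := ready_same_regs sr rdy; rewrite /= E0.
- move=> i s1 lt [sr1 E1 M1].
  apply: runs_weaken (runs_for (Inv := Inv2 i) (n := N)
    (b := comp_cost e N + address_cost a N + 5) _ _ _) (leqnn _) _.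
  + by split; rewrite ?/= ?/update ?eqxx ?v01 //; apply: same_regs_vreg.
  + by move=> j s' [sr E E' M]; have [E0 _ _] := ready_same_regs sr rdy; rewrite /= E0.
  + move=> j s2 ltj [sr2 E2 E2' M2]; have rdy2 := ready_same_regs sr2 rdy.
    apply: runs_weaken (runs_seq (b' := address_cost a N + 4) (runs_comp e 0 rdy2) _)
      _ (fun s x => x); last by lia.
    move=> s3 [m3 v3 k3]; have rdy3 := ready_keep rdy2 k3.
    have iN : i <= N by lia.
    apply: runs_weaken (runs_seq (b' := 3)
      (runs_address (i := i) (j := j) (ri := vreg 0) (rj := vreg 1) a rdy3 _ _ _ iN) _)
      _ (fun s x => x); rewrite ?k3 ?keep_vreg //; last by lia.
    move=> s4 [H4 m4 k4]; apply: runs_store.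
    have sr4 : same_regs s s4.
      apply: same_regs_trans sr2 _ => r r10 r3 r4.
      by rewrite k4 // k3 // keep_small.
    split=> //=.
    * exact: (@same_regs_vreg _ (State (regs s4) _)).
    * by rewrite /update v01 k4 // k3 ?keep_vreg.
    * by rewrite /update eqxx k4 // k3 ?keep_vreg // E2'.
    * move=> b i' j' iN' jN'; rewrite /update H4.
      have Ev : regs s4 (treg 0) = val i j.
        rewrite k4 // v3; apply: Hval => // b' i2 j2 ba i2N j2N.
        by rewrite M2 // (negPf ba).
      case: eqP => [/addr_inj [] // -> -> ->|ne].
        by rewrite eqxx eqxx leqnn orbT Ev.
      rewrite m4 m3 M2 //; case: eqP => //= Eb.
      have -> // : (i' < i) || (i' == i) && (j' < j.+1) =
          ((i' < i) || (i' == i) && (j' < j)).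
      rewrite ltnS [j' <= j]leq_eqVlt; case: (eqVneq j' j) => //= Ej.
      by case: eqP => //= Ei; rewrite Eb Ei Ej in ne.
  move=> s2 [sr2 E2 _ M2]; split=> /=; first exact: same_regs_vreg.
    by rewrite /update eqxx E2.
  move=> b i' j' iN jN; rewrite M2 // ltn0 andbF orbF jN andbT.
  by rewrite orbC -leq_eqVlt ltnS.
- by rewrite /tab_cost.
- move=> s' [sr _ M]; split=> // b i j iN jN; rewrite M //.
  by rewrite addn1 ltnS iN andbT.
Qed.

(** The output overwrites the header and array 0, whose contents are no longer needed by then. These
    [2 + N + N * N] cells have room for every kernel, and the arrays that are still read start right
    after them. *)
Definition out_base N := addr N 1 0 0.

Lemma out_base_le N a i j : 0 < a -> out_base N <= addr N a i j.
Proof. by rewrite /out_base /addr; nia. Qed.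

Definition written (w : seq nat) s : Prop :=
  regs s 6 = size w /\ forall i, i < size w -> memory s i = nth 0 w i.

Definition same_arrays N s s' : Prop :=
  forall z, out_base N <= z -> memory s' z = memory s z.

Definition emit (e : ex) : prog :=
  Seq (comp 0 e) (Seq (Store (Reg 6) (Reg (treg 0))) (Set_reg 6 (Add (Reg 6) (Const 1)))).

Lemma runs_emit N k e w v s : ready N k s -> written w s -> size w < out_base N ->
  ev N k (memory s) (env_of s) e = v ->
  runs (emit e) s (comp_cost e N + 10) (fun s' =>
    [/\ ready N k s', written (rcons w v) s', same_arrays N s s',
        env_of s' =1 env_of s & regs s' 6 = (size w).+1]).
Proof.
move=> rdy [E6 Ew] lt Ev.
apply: runs_weaken (runs_seq (b' := 8) (runs_comp e 0 rdy) _) _ (fun s x => x); last by lia.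
move=> s1 [m1 v1 k1].
apply: (@runs_weaken _ _ (3 + 4).+1); last by move=> s' H; exact: H.
  apply: runs_store_seq; apply: runs_set.
  have R6 : regs s1 6 = size w by rewrite k1.
  have rdy1 := ready_keep rdy k1.
  split.
  - exact: (@ready_update N k (State (regs s1) _)).
  - split=> /=; first by rewrite /update eqxx R6 size_rcons addn1.
    rewrite size_rcons => i lti; rewrite /update nth_rcons R6.
    case: (ltngtP i (size w)) => [il|il|_]; first by rewrite m1 Ew.
      by move: lti il; lia.
    by rewrite v1 Ev.
  - move=> z zl; rewrite /= /update R6 gtn_eqF ?m1 //; exact: leq_trans zl.
  - move=> y; rewrite /env_of /= /update.
    have -> : (vreg y == 6) = false by rewrite /vreg; lia.
    by rewrite k1 ?keep_vreg.
  - by rewrite /= /update eqxx R6 addn1.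
by [].
Qed.

Definition emit_all (c e : ex) : prog :=
  for_loop (vreg 0) (Reg 0) (for_loop (vreg 1) (Reg 0)
    (Seq (comp 0 c) (If (Reg (treg 0)) (emit e) Skip))).

Definition emit_all_cost c e n : nat :=
  for_cost 1 (for_cost 1 (comp_cost c n + comp_cost e n + 15) n) n.

Lemma poly_bounded_emit_all_cost c e : poly_bounded (emit_all_cost c e).
Proof.
have H1 := poly_bounded_comp_cost e; have H2 := poly_bounded_comp_cost c.
by rewrite /emit_all_cost /for_cost; poly_bounded_tac.
Qed.

Definition emitted n (cnd : nat -> nat -> bool) (val : nat -> nat -> nat) i : seq nat :=
  [seq val i j | j <- iota 0 n & cnd i j].

Lemma emittedS n cnd val i : emitted n.+1 cnd val i =
  emitted n cnd val i ++ (if cnd i n then [:: val i n] else [::]).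
Proof.
rewrite /emitted -addn1 iotaD filter_cat map_cat /= add0n.
by case: (cnd i n).
Qed.

(** The size condition keeps the writing position below the arrays, so that [c] and [e] see the same
    data throughout the scan. *)
Lemma runs_emit_all N k c e cnd val w s : ready N k s -> written w s ->
  (forall mem env i j, i < N -> j < N -> env 0 = i -> env 1 = j ->
     (forall z, out_base N <= z -> mem z = memory s z) ->
     (ev N k mem env c != 0) = cnd i j /\ ev N k mem env e = val i j) ->
  size w + size (flatten [seq emitted N cnd val i | i <- iota 0 N]) <= out_base N ->
  runs (emit_all c e) s (emit_all_cost c e N) (fun s' =>
    [/\ ready N k s', same_arrays N s s' &
        written (w ++ flatten [seq emitted N cnd val i | i <- iota 0 N]) s']).
Proof.
move=> rdy wr Hval le_out.
pose out i := flatten [seq emitted N cnd val i' | i' <- iota 0 i].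
have outS i : out i.+1 = out i ++ emitted N cnd val i.
  by rewrite /out -addn1 iotaD map_cat flatten_cat /= cats0.
have out_le i : i <= N -> size (out i) <= size (out N).
  move=> le; rewrite /out.
  have -> : iota 0 N = iota 0 i ++ iota i (N - i) by rewrite -{1}(subnKC le) iotaD.
  by rewrite map_cat flatten_cat size_cat leq_addr.
have em_le i j : j <= N -> size (emitted j cnd val i) <= size (emitted N cnd val i).
  move=> le; rewrite /emitted.
  have -> : iota 0 N = iota 0 j ++ iota j (N - j) by rewrite -{1}(subnKC le) iotaD.
  by rewrite filter_cat map_cat size_cat leq_addr.
pose Inv i s' := [/\ ready N k s', same_arrays N s s', regs s' (vreg 0) = i
  & written (w ++ out i) s'].
pose Inv2 i j s' := [/\ ready N k s', same_arrays N s s',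
  regs s' (vreg 0) = i /\ regs s' (vreg 1) = j
  & written (w ++ out i ++ emitted j cnd val i) s'].
have rdyU s' x y : ready N k s' -> ready N k (State (update (regs s') (vreg x) y) (memory s')).
  by move=> r; apply: ready_update; rewrite // /vreg; lia.
have wrU s' x y u : written u s' -> written u (State (update (regs s') (vreg x) y) (memory s')).
  by case=> E6 Ew; split=> //=; rewrite /update ltn_eqF // /vreg; lia.
apply: runs_weaken (runs_for (Inv := Inv) (n := N)
  (b := for_cost 1 (comp_cost c N + comp_cost e N + 15) N) _ _ _) _ _.
- by split; [exact: rdyU| | |apply: wrU; rewrite cats0].
- by move=> i s' [[E0 _ _] _ Ei _]; split.
- move=> i s1 lti [rdy1 sa1 E1 wr1].
  apply: runs_weaken (runs_for (Inv := Inv2 i) (n := N)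
    (b := comp_cost c N + comp_cost e N + 15) _ _ _) (leqnn _) _.
  + split; [exact: rdyU|by []|by rewrite /= /update|].
    by apply: wrU; rewrite /emitted /= cats0.
  + by move=> j s' [[E0 _ _] _ [_ Ej] _]; split.
  + move=> j s2 ltj [rdy2 sa2 [E20 E21] wr2].
    apply: runs_weaken (runs_seq (b' := comp_cost e N + 13) (runs_comp c 0 rdy2) _) _
      (fun s x => x); last by lia.
    move=> s3 [m3 v3 k3]; have rdy3 := ready_keep rdy2 k3.
    have E30 : regs s3 (vreg 0) = i by rewrite k3 ?keep_vreg.
    have E31 : regs s3 (vreg 1) = j by rewrite k3 ?keep_vreg.
    have sa3 : same_arrays N s s3 by move=> z /sa2; rewrite m3.
    have wr3 : written (w ++ out i ++ emitted j cnd val i) s3.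
      by case: wr2 => E6 Ew; split; rewrite ?k3 // m3.
    have [Hc _] := Hval _ (env_of s2) _ _ lti ltj E20 E21 sa2.
    have [_ He3] := Hval _ (env_of s3) _ _ lti ltj E30 E31 sa3.
    have fin s4 : ready N k s4 -> same_arrays N s s4 -> regs s4 (vreg 0) = i ->
        regs s4 (vreg 1) = j -> written (w ++ out i ++ emitted j.+1 cnd val i) s4 ->
        Inv2 i j.+1 (State (update (regs s4) (vreg 1) (regs s4 (vreg 1)).+1) (memory s4)).
      move=> rdy4 sa4 E40 E41 wr4; split; [exact: rdyU|by []| |exact: wrU].
      by rewrite /= /update /= E40 E41.
    apply: runs_weaken (runs_if (b := comp_cost e N + 10) (b' := 1) _ _) _ (fun s x => x);
      last by rewrite /=; lia.
      rewrite /= v3 Hc => cij.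
      have szl : size (w ++ out i ++ emitted j cnd val i) < out_base N.
        apply: leq_trans le_out; rewrite !size_cat ltn_add2l.
        apply: leq_trans (out_le i.+1 lti); rewrite outS size_cat ltn_add2l.
        by apply: leq_trans (em_le i j.+1 ltj); rewrite emittedS cij size_cat addn1.
      apply: runs_weaken (runs_emit rdy3 wr3 szl He3) (leqnn _) _.
      move=> s4 [rdy4 wr4 sa4 env4 _]; apply: fin => //.
      * by move=> z zl; rewrite sa4 // sa3.
      * by have := env4 0; rewrite /env_of => ->.
      * by have := env4 1; rewrite /env_of => ->.
      * by rewrite emittedS cij; move: wr4; rewrite -cats1 -!catA.
    move=> /eqP /=; rewrite v3 -[_ == 0]negbK Hc => /negbTE cij.
    by apply: runs_skip; apply: fin => //; rewrite emittedS cij cats0.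
  move=> s2 [rdy2 sa2 [E20 _] wr2]; split; [exact: rdyU|by []|by rewrite /= /update eqxx E20|].
  by apply: wrU; rewrite outS.
- by rewrite /emit_all_cost.
- by move=> s' [rdy' sa' _ wr'].
Qed.

(** The array size [N * N + N] is formed by adding [N] repeatedly, for want of a multiplication. *)
Definition init_prog : prog :=
  Seq (Set_reg 0 (Fetch (Const 0))) (Seq (Set_reg 1 (Fetch (Const 1)))
 (Seq (Set_reg 2 (Reg 0)) (for_loop 4 (Reg 0) (Set_reg 2 (Add (Reg 2) (Reg 0)))))).

Lemma runs_init N k s : memory s 0 = N -> memory s 1 = k -> regs s 6 = 0 ->
  runs init_prog s (20 * N + 40) (fun s' =>
    [/\ ready N k s', memory s' = memory s & regs s' 6 = 0]).
Proof.
move=> EN Ek E6.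
apply: runs_weaken (runs_set_seq (b := 20 * N + 30) _) _ (fun s x => x); last by rewrite /=; lia.
apply: runs_weaken (runs_set_seq (b := 20 * N + 25) _) _ (fun s x => x); last by rewrite /=; lia.
apply: runs_weaken (runs_set_seq (b := 20 * N + 20) _) _ (fun s x => x); last by rewrite /=; lia.
apply: runs_weaken (runs_for (n := N) (b := 4) (Inv := fun i s' =>
  [/\ regs s' 0 = N, regs s' 1 = k, regs s' 2 = N + i * N, regs s' 4 = i &
      memory s' = memory s /\ regs s' 6 = 0]) _ _ _) _ _.
- by split; rewrite //= /update /= ?EN ?Ek //; lia.
- by move=> i s' [E0 _ _ E4 _].
- move=> i s' lt [E0 E1 E2 E4 [Em E6']]; apply: runs_set.
  by split; rewrite //= /update /= ?E0 ?E1 ?E2 ?E4 //; lia.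
- by rewrite /for_cost /=; lia.
- by move=> s' [E0 E1 E2 _ [Em E6']]; split=> //; split=> //; rewrite E2; lia.
Qed.

(** * The reduction rules as expressions *)

Definition And a b := Ite a b (Cst 0).
Definition Or a b := Ite a (Cst 1) b.
Definition Not a := Ite a (Cst 0) (Cst 1).
Definition Imp a b := Ite a b (Cst 1).
Definition Iff a b := Ite a b (Not b).
(** Truth means being nonzero, so truncated subtraction already is strict comparison. *)
Definition Lt a b := Minus b a.
Definition Le a b := Minus (Plus b (Cst 1)) a.
Definition Eqv a b := Not (Plus (Minus a b) (Minus b a)).
Definition Bool a := Ite a (Cst 1) (Cst 0).
Definition Count x a := Sum x (Bool a).
Definition All x a := Not (Count x (Not a)).

Section Truth.
Variables (N k : nat) (mem : nat -> nat).
Implicit Types (env : nat -> nat) (a b : ex).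

Definition tr env a : bool := ev N k mem env a != 0.

Lemma tr_ite env c a b : tr env (Ite c a b) = if tr env c then tr env a else tr env b.
Proof. by rewrite /tr /=; case: (ev N k mem env c == 0). Qed.

Lemma tr_and env a b p q : tr env a = p -> tr env b = q -> tr env (And a b) = p && q.
Proof. by rewrite tr_ite => -> ->; case: p. Qed.

Lemma tr_or env a b p q : tr env a = p -> tr env b = q -> tr env (Or a b) = p || q.
Proof. by rewrite tr_ite => -> ->; case: p. Qed.

Lemma tr_not env a p : tr env a = p -> tr env (Not a) = ~~ p.
Proof. by rewrite tr_ite => ->; case: p. Qed.

Lemma tr_imp env a b p q : tr env a = p -> tr env b = q -> tr env (Imp a b) = (p ==> q).
Proof. by rewrite tr_ite => -> ->; case: p. Qed.

Lemma tr_iff env a b p q : tr env a = p -> tr env b = q -> tr env (Iff a b) = (p == q).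
Proof. by move=> Hp Hq; rewrite tr_ite (tr_not Hq) Hp Hq; case: p {Hp}; case: q {Hq}. Qed.

Lemma tr_lt env a b m n : ev N k mem env a = m -> ev N k mem env b = n ->
  tr env (Lt a b) = (m < n).
Proof. by move=> <- <-; rewrite /tr /=; lia. Qed.

Lemma tr_le env a b m n : ev N k mem env a = m -> ev N k mem env b = n ->
  tr env (Le a b) = (m <= n).
Proof. by move=> <- <-; rewrite /tr /=; lia. Qed.

Lemma tr_eqv env a b m n : ev N k mem env a = m -> ev N k mem env b = n ->
  tr env (Eqv a b) = (m == n).
Proof. by move=> <- <-; rewrite (tr_not (erefl _)) /tr /=; lia. Qed.

Lemma ev_bool env a p : tr env a = p -> ev N k mem env (Bool a) = p.
Proof. by move=> <-; rewrite /tr /=; case: (ev N k mem env a == 0). Qed.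

Lemma ev_count env x a (P : pred 'I_N) : (forall i : 'I_N, tr (update env x i) a = P i) ->
  ev N k mem env (Count x a) = #|[set i | P i]|.
Proof.
move=> H; rewrite -sum1_card big_mkcond /=; apply: eq_bigr => i _.
by rewrite inE; apply: etrans (ev_bool (H i)) _; case: (P i).
Qed.

Lemma tr_all env x a (P : pred 'I_N) : (forall i : 'I_N, tr (update env x i) a = P i) ->
  tr env (All x a) = [forall i, P i].
Proof.
move=> H; rewrite /All (tr_not (erefl _)) /tr.
rewrite (ev_count (fun i => tr_not (H i))) negbK cards_eq0; apply/eqP/forallP => H'.
  move=> i; have : i \notin [set i0 | ~~ P i0] by rewrite H' inE.
  by rewrite inE negbK.
by apply/setP => i; rewrite !inE H'.
Qed.

Lemma tr_ex env x a (P : pred 'I_N) : (forall i : 'I_N, tr (update env x i) a = P i) ->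
  tr env (Count x a) = [exists i, P i].
Proof.
move=> H; rewrite /tr (ev_count H) -lt0n; apply/card_gt0P/existsP => -[i];
by rewrite ?inE => Pi; exists i; rewrite ?inE.
Qed.

End Truth.

(** The least index satisfying [P], or [N] if there is none, written as a cardinality so that a
    bounded sum can compute it. *)
Definition first N (P : pred 'I_N) : nat :=
  #|[set i : 'I_N | [forall j : 'I_N, (j <= i) ==> ~~ P j]]|.

Lemma card_ord_lt N p : p <= N -> #|[set i : 'I_N | i < p]| = p.
Proof.
move=> le; have -> : #|[set i : 'I_N | i < p]| = count (fun r => r < p) (iota 0 N).
  rewrite -val_enum_ord count_map -size_filter cardE; apply: perm_size.
  apply: uniq_perm; [exact: enum_uniq|exact/filter_uniq/enum_uniq|].
  by move=> z; rewrite mem_enum mem_filter inE mem_enum andbT.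
by rewrite count_iota_lt; lia.
Qed.

Lemma firstP N (P : pred 'I_N) :
  (exists2 p : 'I_N, first P = p & P p) \/ (first P = N /\ forall i, ~~ P i).
Proof.
case: (pickP P) => [x Px|noP].
  case: (arg_minnP (fun i : 'I_N => i : nat) Px) => p Pp pmin.
  left; exists p => //; rewrite -[RHS](card_ord_lt (ltnW (ltn_ord p))).
  apply: eq_card => i; rewrite !inE; apply/forallP/idP => [H|lt j].
    by rewrite ltnNge; apply/negP => le; have := H p; rewrite le Pp.
  apply/implyP => le; apply/negP => Pj; have := pmin j Pj.
  by rewrite leqNgt (leq_ltn_trans le lt).
right; split=> [|i]; last by rewrite noP.
rewrite /first -[RHS]card_ord -cardsT; apply: eq_card => i; rewrite !inE.
by apply/forallP => j; rewrite noP implybT.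
Qed.

Definition eTer x := Get 1 (Cst 0) (Var x).
Definition eAlive x := Get 2 (Cst 0) (Var x).
Definition eArc x y := Get 1 (Plus (Var x) (Cst 1)) (Var y).

(** Bound variables have numbers from 20 on; side conditions such as [x != 20] in the correctness
    lemmas exclude capture. *)
Definition eSame x y :=
  All 20 (Imp (And (eTer 20) (eAlive 20)) (Iff (eArc 20 x) (eArc 20 y))).
Definition eClass x y := And (eAlive y) (And (Not (eTer y)) (eSame x y)).
Definition eCore x z := And (eClass x z)
  (And (Lt Par (Count 21 (And (eClass x 21) (eArc 21 z))))
       (Lt Par (Count 21 (And (eClass x 21) (eArc z 21))))).
Definition eThrice := Plus Par (Plus Par (Plus Par (Cst 3))).
Definition eClassRule x :=
  And (eAlive x) (And (Not (eTer x)) (Lt eThrice (Count 22 (eCore x 22)))).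
Definition eFirst (P : nat -> ex) :=
  Count 23 (All 24 (Imp (Le (Var 24) (Var 23)) (Not (P 24)))).

Definition eRank p x := Count 25 (And (eCore p 25) (Lt (Var 25) (Var x))).
Definition eIndeg p x := Let 26 (Count 25 (And (eCore p 25) (eArc 25 x)))
  (Ite (Lt (Plus Par (Cst 1)) (Var 26)) (Minus (Var 26) (Cst 1)) (Var 26)).
Definition eCyclic r t :=
  let h := Plus Par (Plus Par (Cst 2)) in
  Ite (And (Le (Var r) Par) (Le h (Var t))) (Cst 0)
    (Ite (And (Le (Var t) Par) (Le h (Var r))) (Cst 1) (Lt (Var r) (Var t))).
Definition eRewired p x y :=
  Ite (eCore p x)
    (Ite (eCore p y) (Let 27 (eRank p x) (Let 28 (eRank p y) (eCyclic 27 28)))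
       (Lt (eRank p x) (eIndeg p y)))
    (Ite (eCore p y) (Not (Lt (eRank p y) (eIndeg p x))) (eArc x y)).

Definition eBetween u w x := And (eAlive x)
  (Or (Eqv (Var x) (Var u)) (Or (Eqv (Var x) (Var w)) (And (eArc u x) (eArc x w)))).
Definition eClean u w := And
  (All 31 (Imp (eAlive 31) (Imp (Not (eBetween u w 31))
    (All 32 (Imp (eBetween u w 32) (All 33 (Imp (eBetween u w 33)
       (Iff (eArc 31 32) (eArc 31 33)))))))))
  (All 31 (Imp (And (eTer 31) (eBetween u w 31))
    (All 32 (Imp (eBetween u w 32) (All 33 (Imp (eBetween u w 33)
       (Imp (eArc 31 32) (Imp (eArc 32 33) (Not (eArc 33 31)))))))))).
Definition eEight :=
  let q := Plus Par Par in let r := Plus q q in Plus (Plus r r) (Cst 6).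
Definition eModuleRule u := And (eTer u) (And (eAlive u)
  (Count 29 (And (eTer 29) (And (eAlive 29) (And (eClean u 29)
     (Lt eEight (Count 30 (eBetween u 29 30)))))))).

(** * Agreement of the expressions with the graph notions *)

Section Specs.
Variables (N k : nat) (mem : nat -> nat) (S A : {set 'I_N}) (e : rel 'I_N).
Implicit Types (env : nat -> nat) (i j : 'I_N).

Definition represents : Prop := forall i j,
  [/\ (mem (addr N 1 0 j) != 0) = (j \in S), (mem (addr N 2 0 j) != 0) = (j \in A) &
      (mem (addr N 1 i.+1 j) != 0) = e i j].

Hypothesis rep : represents.
Local Notation tr := (tr N k mem).
Local Notation ev := (ev N k mem).

Lemma tr_ter env x i : env x = i -> tr env (eTer x) = (i \in S).
Proof. by rewrite /tr /= => ->; rewrite ltn_ord /=; case: (rep i i). Qed.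

Lemma tr_alive env x i : env x = i -> tr env (eAlive x) = (i \in A).
Proof. by rewrite /tr /= => ->; rewrite ltn_ord /=; case: (rep i i). Qed.

Lemma tr_arc env x y i j : env x = i -> env y = j -> tr env (eArc x y) = e i j.
Proof. by rewrite /tr /= => -> ->; rewrite addn1 !ltn_ord /=; case: (rep i j). Qed.

Lemma upd_neq env x y v i : x != y -> env x = i -> update env y v x = i.
Proof. by rewrite /update => /negPf ->. Qed.

Lemma upd_eq env x v : update env x v x = v.
Proof. by rewrite /update eqxx. Qed.

Lemma tr_same env x y i j : x != 20 -> y != 20 -> env x = i -> env y = j ->
  tr env (eSame x y) = same_type S A e i j.
Proof.
move=> nx ny Ex Ey; apply: tr_all => s.
rewrite in_setI; apply: tr_imp; first by apply: tr_and; [apply: tr_ter|apply: tr_alive].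
by apply: tr_iff; apply: tr_arc => //; apply: upd_neq.
Qed.

Lemma tr_class env x y i j : x != 20 -> y != 20 -> env x = i -> env y = j ->
  tr env (eClass x y) = (j \in class S A e i).
Proof.
move=> nx ny Ex Ey; rewrite inE; apply: tr_and; first exact: tr_alive.
by apply: tr_and; [apply/tr_not/tr_ter|apply: tr_same].
Qed.

Lemma tr_core env x z i j : (x != 20) && (x != 21) -> (z != 20) && (z != 21) ->
  env x = i -> env z = j -> tr env (eCore x z) = (j \in core S A e k i).
Proof.
move=> /andP[x1 x2] /andP[z1 z2] Ex Ez; rewrite inE.
apply: tr_and; first exact: tr_class.
apply: tr_and; apply: tr_lt => //; apply: ev_count => y; apply: tr_and;
  try (by apply: tr_class => //; apply: upd_neq);
  by apply: tr_arc => //; apply: upd_neq.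
Qed.

Lemma card_count env x a (Y : {set 'I_N}) : (forall i : 'I_N, tr (update env x i) a = (i \in Y)) ->
  ev env (Count x a) = #|Y|.
Proof. by move=> H; rewrite (ev_count H); apply: eq_card => i; rewrite inE. Qed.

Definition class_rule_at i := [&& i \in A, i \notin S & 3 * k + 3 < #|core S A e k i|].

Lemma tr_class_rule env x i : [&& x != 20, x != 21 & x != 22] -> env x = i ->
  tr env (eClassRule x) = class_rule_at i.
Proof.
move=> /and3P[x1 x2 x3] Ex; apply: tr_and; first exact: tr_alive.
apply: tr_and; first exact/tr_not/tr_ter.
apply: tr_lt; first by rewrite /=; lia.
apply: card_count => z; apply: tr_core; rewrite ?x1 ?x2 ?upd_eq //.
exact: upd_neq.
Qed.

Lemma ev_first env (P : nat -> ex) (Q : pred 'I_N) :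
  (forall env i, env 24 = i -> tr env (P 24) = Q i) -> ev env (eFirst P) = first Q.
Proof.
move=> H; apply: ev_count => i; apply: tr_all => j.
by apply: tr_imp; [apply: tr_le|apply/tr_not/H].
Qed.

Lemma tr_between env u w x i j (y : 'I_N) : env u = i -> env w = j -> env x = y ->
  tr env (eBetween u w x) = (y \in between A e i j).
Proof.
move=> Eu Ew Ex; rewrite inE; apply: tr_and; first exact: tr_alive.
apply: tr_or; first by apply: tr_eqv; rewrite /= ?Ex ?Eu.
apply: tr_or; first by apply: tr_eqv; rewrite /= ?Ex ?Ew.
by apply: tr_and; apply: tr_arc.
Qed.

Lemma tr_clean env u w i j :
  [&& u != 31, u != 32 & u != 33] -> [&& w != 31, w != 32 & w != 33] ->
  env u = i -> env w = j ->
  tr env (eClean u w) = clean_module S A e (between A e i j).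
Proof.
move=> /and3P[u1 u2 u3] /and3P[w1 w2 w3] Eu Ew.
have U1 y : update env 31 y u = i by apply: upd_neq.
have W1 y : update env 31 y w = j by apply: upd_neq.
have U2 y x : update (update env 31 y) 32 x u = i by apply: upd_neq.
have W2 y x : update (update env 31 y) 32 x w = j by apply: upd_neq.
have U3 y x z : update (update (update env 31 y) 32 x) 33 z u = i by apply: upd_neq.
have W3 y x z : update (update (update env 31 y) 32 x) 33 z w = j by apply: upd_neq.
apply: tr_and.
  apply: tr_all => y; apply: tr_imp; first exact: tr_alive.
  apply: tr_imp; first exact/tr_not/tr_between.
  apply: tr_all => x; apply: tr_imp; first exact: tr_between.
  apply: tr_all => x'; apply: tr_imp; first exact: tr_between.
  by apply: tr_iff; apply: tr_arc.
apply: tr_all => y; rewrite in_setI; apply: tr_imp.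
  by apply: tr_and; [apply: tr_ter|apply: tr_between].
apply: tr_all => x; apply: tr_imp; first exact: tr_between.
apply: tr_all => x'; apply: tr_imp; first exact: tr_between.
apply: tr_imp; first exact: tr_arc.
by apply: tr_imp; [apply: tr_arc|apply/tr_not/tr_arc].
Qed.

Definition module_rule_at i := [&& i \in S, i \in A &
  [exists j, [&& j \in S, j \in A, clean_module S A e (between A e i j) &
     8 * k + 6 < #|between A e i j|]]].

Lemma tr_module_rule env u i : u \notin [:: 29; 30; 31; 32; 33] -> env u = i ->
  tr env (eModuleRule u) = module_rule_at i.
Proof.
rewrite !in_cons in_nil orbF !negb_or => /and5P[u29 u30 u31 u32 u33] Eu.
apply: tr_and; first exact: tr_ter.
apply: tr_and; first exact: tr_alive.
apply: tr_ex => w; have Eu' : update env 29 w u = i by apply: upd_neq.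
apply: tr_and; first exact: tr_ter.
apply: tr_and; first exact: tr_alive.
apply: tr_and; first by apply: tr_clean; rewrite ?u31 ?u32 ?u33.
apply: tr_lt; first by rewrite /=; lia.
by apply: card_count => x; apply: tr_between => //; apply: upd_neq.
Qed.

Section Rewire.
Variable p : 'I_N.
Let Z := core S A e k p.

Lemma ev_rank env x i : env 2 = p -> x < 20 -> env x = i -> ev env (eRank 2 x) = rank Z i.
Proof.
move=> Ep x20 Ex; apply: card_count => z; rewrite inE; apply: tr_and.
  exact: tr_core.
by apply: tr_lt => //=; apply: upd_neq => //; lia.
Qed.

Lemma ev_indeg env x i : env 2 = p -> x < 20 -> env x = i ->
  ev env (eIndeg 2 x) = reduced_indegree e Z k i.
Proof.
move=> Ep x20 Ex; rewrite /eIndeg /reduced_indegree.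
have <- : ev env (Count 25 (And (eCore 2 25) (eArc 25 x))) = #|[set z in Z | e z i]|.
  apply: card_count => z; rewrite inE; apply: tr_and; first exact: tr_core.
  by apply: tr_arc => //; apply: upd_neq => //; lia.
move: (Count 25 _) => c /=; rewrite !upd_eq addn1 subn1.
by case: (ltnP k.+1 _) => h; case: eqP => //; lia.
Qed.

Lemma tr_cyclic env r t a b : env r = a -> env t = b ->
  tr env (eCyclic r t) = cyclic_arc k a b.
Proof.
move=> Er Et; rewrite /eCyclic /cyclic_arc tr_ite (tr_and (p := a <= k) (q := k.*2.+2 <= b)).
- case: (_ && _) => //; rewrite tr_ite (tr_and (p := b <= k) (q := k.*2.+2 <= a)).
  + by case: (_ && _) => //; apply: tr_lt.
  + exact: tr_le.
  + by apply: tr_le => //=; lia.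
- exact: tr_le.
- by apply: tr_le => //=; lia.
Qed.

Lemma tr_rewired env x y i j : env 2 = p -> x < 20 -> y < 20 -> env x = i -> env y = j ->
  tr env (eRewired 2 x y) = rewired e Z k i j.
Proof.
move=> Ep x20 y20 Ex Ey.
have Tx : tr env (eCore 2 x) = (i \in Z) by apply: tr_core => //; lia.
have Ty : tr env (eCore 2 y) = (j \in Z) by apply: tr_core => //; lia.
rewrite /eRewired /rewired tr_ite Tx; case: (i \in Z).
  rewrite tr_ite Ty; case: (j \in Z); last by apply: tr_lt; [apply: ev_rank|apply: ev_indeg].
  rewrite -(@tr_cyclic (update (update env 27 (rank Z i)) 28 (rank Z j)) 27 28) //.
  rewrite /tr -(ev_rank Ep x20 Ex); congr (_ != 0).
  rewrite -(@ev_rank (update env 27 (ev env (eRank 2 x))) y j) //.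
  by apply: upd_neq => //; lia.
rewrite tr_ite Ty; case: (j \in Z); last exact: tr_arc.
by apply: tr_not; apply: tr_lt; [apply: ev_rank|apply: ev_indeg].
Qed.

End Rewire.
End Specs.

(** * One reduction step *)

(** The new content of cell [(Var 0, Var 1)] of array 1: row 0 repeats the terminals, and row
    [i + 1] belongs to vertex [i], hence the subtraction of 1. *)
Definition eNewArc := Bool (Ite (Var 0)
  (Let 3 (Minus (Var 0) (Cst 1)) (Let 2 (eFirst eClassRule)
     (Ite (Lt (Var 2) Siz) (eRewired 2 3 1) (eArc 3 1))))
  (eTer 1)).

(** Without a class rule, the first vertex admitting the module rule dies. If there is none,
    [eFirst] returns [N], which is no vertex, and nothing changes. *)
Definition eNewAlive := Bool (Let 2 (eFirst eClassRule) (And (eAlive 1)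
  (Not (Ite (Lt (Var 2) Siz)
     (And (eCore 2 1) (Eqv (Plus (eRank 2 1) (Cst 1)) (Count 25 (eCore 2 25))))
     (Eqv (Var 1) (eFirst eModuleRule)))))).

Section Step.
Variables (N k : nat) (S : {set 'I_N}).
Implicit Types (A : {set 'I_N}) (e : rel 'I_N).

Definition irreducible A e : bool :=
  [forall i, ~~ class_rule_at k S A e i] && [forall i, ~~ module_rule_at k S A e i].

Lemma irreducible_class_le A e x : tournament_on A e ->
  (forall i, ~~ class_rule_at k S A e i) -> x \in A -> x \notin S ->
  #|class S A e x| <= 7 * k + 5.
Proof.
move=> tour irr xA xS; apply: card_class_le => //.
by have := irr x; rewrite /class_rule_at xA xS /= -leqNgt.
Qed.

Lemma irreducible_card A e : tournament_on A e -> irreducible A e ->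
  solvable S A e k -> #|A| <= 128 * (k ^ 2 + 1).
Proof.
move=> tour /andP[/forallP irr1 /forallP irr2] sol.
apply: card_irreducible sol _ _ => // [x|u w uS wS uA wA cl].
  exact: irreducible_class_le.
rewrite leqNgt; apply/negP => big; have := irr2 u; rewrite /module_rule_at uS uA /=.
by move/existsPn/(_ w); rewrite wS wA cl big.
Qed.

(** An irreducible instance is a fixed point, so running the step a fixed number [N] of times is
    safe and no termination test is needed. *)
Definition step_spec A e A' e' : Prop :=
  [/\ tournament_on A' e', solvable S A e k <-> solvable S A' e' k,
      (if irreducible A e then A' = A /\ e' = e else #|A'| < #|A|) &
      forall mem env, represents mem S A e ->
        (forall i j : 'I_N, env 0 = i.+1 -> env 1 = j -> ev N k mem env eNewArc = e' i j) /\
        (forall j : 'I_N, env 1 = j -> ev N k mem env eNewAlive = (j \in A'))].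

Lemma step_exists A e : tournament_on A e -> exists A' e', step_spec A e A' e'.
Proof.
move=> tour; pose P := class_rule_at k S A e; pose Q := module_rule_at k S A e.
have evP mem env : represents mem S A e -> ev N k mem env (eFirst eClassRule) = first P.
  by move=> rep; apply: ev_first => env' i E; apply: tr_class_rule.
have evQ mem env : represents mem S A e -> ev N k mem env (eFirst eModuleRule) = first Q.
  by move=> rep; apply: ev_first => env' i E; apply: tr_module_rule.
case: (firstP P) => [[p Ep Pp]|[Ep noP]].
  have [pA pS big] := and3P Pp; pose Z := core S A e k p.
  have [z0] : exists z0, z0 \in [set z in Z | rank Z z == #|Z|.-1].
    apply/set0Pn; rewrite -card_gt0 (card_rank Z (pred1 #|Z|.-1)).
    by rewrite -has_count has_pred1 mem_iota; move: big; rewrite -/Z; lia.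
  rewrite inE => /andP[z0Z /eqP rz0].
  have [tour' iff] := class_rule tour pA pS big z0Z rz0.
  exists (A :\ z0), (rewired e Z k); split=> //.
    have -> : irreducible A e = false.
      by apply/negP => /andP[/forallP/(_ p)]; rewrite -/P Pp.
    have z0A : z0 \in A by move: z0Z; rewrite inE => /andP[]; rewrite inE => /andP[].
    by rewrite (cardsD1 z0 A) z0A.
  move=> mem env rep; split=> [i j E0 E1|j E1].
    apply: ev_bool; rewrite tr_ite.
    have -> : tr N k mem env (Var 0) by rewrite /tr /= E0.
    rewrite /tr -[ev _ _ _ _ _]/(ev N k mem (update (update env 3 (env 0 - 1)) 2
       (ev N k mem (update env 3 (env 0 - 1)) (eFirst eClassRule)))
       (Ite (Lt (Var 2) Siz) (eRewired 2 3 1) (eArc 3 1))) evP // Ep.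
    set env' := update _ 2 _; rewrite -/(tr N k mem env' _) tr_ite.
    rewrite (tr_lt (m := p) (n := N)) // ltn_ord; apply: tr_rewired => //.
    by rewrite /env' /update /= E0 subn1.
  apply: ev_bool.
  rewrite /tr -[ev _ _ _ _ _]/(ev N k mem (update env 2
       (ev N k mem env (eFirst eClassRule))) (And (eAlive 1)
  (Not (Ite (Lt (Var 2) Siz)
     (And (eCore 2 1) (Eqv (Plus (eRank 2 1) (Cst 1)) (Count 25 (eCore 2 25))))
     (Eqv (Var 1) (eFirst eModuleRule)))))) evP // Ep.
  set env' := update _ 2 _; rewrite -/(tr N k mem env' _) !inE andbC.
  apply: tr_and; first exact: tr_alive.
  apply: tr_not; rewrite tr_ite (tr_lt (m := p) (n := N)) // ltn_ord.
  apply: (@etrans _ _ ((j \in Z) && (rank Z j + 1 == #|Z|))).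
    apply: tr_and; first exact: tr_core.
    apply: tr_eqv; last by apply: card_count => z; apply: tr_core.
    by congr (_ + 1); apply: ev_rank.
  apply/andP/eqP => [[jZ /eqP rj]|->]; last first.
    by split=> //; rewrite rz0; move: big; rewrite -/Z; lia.
  by apply: (rank_inj jZ z0Z); rewrite rz0 -rj addn1.
have ltP mem env : tr N k mem (update env 2 N) (Lt (Var 2) Siz) = false.
  by rewrite (tr_lt (m := N) (n := N)) // ltnn.
have arcs mem env : represents mem S A e -> forall i j : 'I_N,
    env 0 = i.+1 -> env 1 = j -> ev N k mem env eNewArc = e i j.
  move=> rep i j E0 E1; apply: ev_bool; rewrite tr_ite.
  have -> : tr N k mem env (Var 0) by rewrite /tr /= E0.
  rewrite /tr -[ev _ _ _ _ _]/(ev N k mem (update (update env 3 (env 0 - 1)) 2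
       (ev N k mem (update env 3 (env 0 - 1)) (eFirst eClassRule)))
       (Ite (Lt (Var 2) Siz) (eRewired 2 3 1) (eArc 3 1))) evP // Ep.
  set env' := update _ 2 _; rewrite -/(tr N k mem env' _) tr_ite ltP.
  by apply: tr_arc => //; rewrite /env' /update /= E0 subn1.
have alive mem (env : nat -> nat) : represents mem S A e -> forall j : 'I_N,
    env 1 = j -> ev N k mem env eNewAlive = (j \in A) && (j != first Q :> nat).
  move=> rep j E1; apply: ev_bool.
  rewrite /tr -[ev _ _ _ _ _]/(ev N k mem (update env 2
       (ev N k mem env (eFirst eClassRule))) (And (eAlive 1)
  (Not (Ite (Lt (Var 2) Siz)
     (And (eCore 2 1) (Eqv (Plus (eRank 2 1) (Cst 1)) (Count 25 (eCore 2 25))))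
     (Eqv (Var 1) (eFirst eModuleRule)))))) evP // Ep.
  set env' := update _ 2 _; rewrite -/(tr N k mem env' _).
  apply: tr_and; first exact: tr_alive.
  by apply: tr_not; rewrite tr_ite ltP; apply: tr_eqv => //; apply: evQ.
case: (firstP Q) => [[u Eu Qu]|[Eu noQ]].
  have [uS uA /existsP [w /and4P[wS wA cl big]]] := and3P Qu.
  exists (A :\ u), e; split.
  - by apply: tournament_onS tour; apply: subD1set.
  - apply: (module_rule tour uS wS uA wA _ cl big) => x.
    exact: irreducible_class_le.
  - have -> : irreducible A e = false.
      by apply/negP => /andP[_ /forallP/(_ u)]; rewrite -/Q Qu.
    by rewrite (cardsD1 u A) uA.
  - move=> mem env rep; split; first exact: arcs.
    by move=> j E1; rewrite (alive _ _ rep _ E1) Eu !inE andbC.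
exists A, e; split=> //.
  by have -> : irreducible A e by apply/andP; split; apply/forallP.
move=> mem env rep; split; first exact: arcs.
by move=> j E1; rewrite (alive _ _ rep _ E1) Eu ltn_eqF ?ltn_ord ?andbT.
Qed.

End Step.

(** Array contents are functions on all naturals; the lifts extend sets and relations by false. *)
Definition lift1 N (B : {set 'I_N}) (j : nat) : bool := [exists y : 'I_N, (y == j :> nat) && (y \in B)].
Definition lift2 N (f : rel 'I_N) (i j : nat) : bool :=
  [exists x : 'I_N, exists y : 'I_N, [&& x == i :> nat, y == j :> nat & f x y]].

Lemma lift1E N (B : {set 'I_N}) (j : 'I_N) : lift1 B j = (j \in B).
Proof.
apply/existsP/idP => [[y /andP[/eqP E yB]]|jB]; first by rewrite -(val_inj E).
by exists j; rewrite eqxx.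
Qed.

Lemma lift2E N (f : rel 'I_N) (i j : 'I_N) : lift2 f i j = f i j.
Proof.
apply/existsP/idP => [[x /existsP [y /and3P[/eqP Ex /eqP Ey fxy]]]|fij].
  by rewrite -(val_inj Ex) -(val_inj Ey).
by exists i; apply/existsP; exists j; rewrite !eqxx.
Qed.

Definition copy a := Get a (Var 0) (Var 1).

(** The new tables go to arrays 3 and 4 first, because every new entry depends on the whole old
    graph. *)
Definition body : prog :=
  Seq (tab 3 eNewArc) (Seq (tab 4 eNewAlive) (Seq (tab 1 (copy 3)) (tab 2 (copy 4)))).

Definition body_cost n :=
  tab_cost 3 eNewArc n + tab_cost 4 eNewAlive n +
  tab_cost 1 (copy 3) n + tab_cost 2 (copy 4) n + 3.

Lemma represents_eq N (S A : {set 'I_N}) e mem mem' : represents mem S A e ->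
  (forall b i j, b \in [:: 1; 2] -> i <= N -> j < N ->
     mem' (addr N b i j) = mem (addr N b i j)) -> represents mem' S A e.
Proof. by move=> rep H i j; rewrite !H ?ltn_ord //; apply: rep. Qed.

Lemma ev_copy N k mem env a i j : i <= N -> j < N -> env 0 = i -> env 1 = j ->
  ev N k mem env (copy a) = mem (addr N a i j).
Proof. by move=> iN jN E0 E1; rewrite /= E0 E1 iN jN. Qed.

Lemma runs_body N k (S A A' : {set 'I_N}) (e e' : rel 'I_N) s : ready N k s ->
  represents (memory s) S A e -> step_spec k S A e A' e' ->
  runs body s (body_cost N) (fun s' => same_regs s s' /\ represents (memory s') S A' e').
Proof.
move=> rdy rep [_ _ _ step].
pose val3 i j : nat := if i is i'.+1 then lift2 e' i' j else lift1 S j.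
pose val4 (i j : nat) : nat := lift1 A' j.
apply: runs_weaken (runs_seq (b' := tab_cost 4 eNewAlive N +
  tab_cost 1 (copy 3) N + tab_cost 2 (copy 4) N + 2) (runs_tab (val := val3) rdy _) _) _
  (fun s x => x); last by rewrite /body_cost; lia.
  move=> mem env i j iN jN E0 E1 Hm.
  have rep' : represents mem S A e by apply: represents_eq rep _ => b i' j' b12; apply: Hm; move: b12; rewrite !inE; lia.
  have Ej : j = Ordinal jN by [].
  case: i iN E0 => [|i] iN E0.
    apply: etrans (ev_bool (p := Ordinal jN \in S) _) _; last by rewrite -lift1E.
    rewrite tr_ite; have -> : tr N k mem env (Var 0) = false by rewrite /tr /= E0.
    exact: tr_ter.
  have [H _] := step mem env rep'.
  by rewrite (H (Ordinal iN) (Ordinal jN)) // -lift2E.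
move=> s1 [sr1 m1]; have rdy1 := ready_same_regs sr1 rdy.
apply: runs_weaken (runs_seq (b' :=
  tab_cost 1 (copy 3) N + tab_cost 2 (copy 4) N + 1) (runs_tab (val := val4) rdy1 _) _) _
  (fun s x => x); last by lia.
  move=> mem env i j iN jN E0 E1 Hm.
  have rep' : represents mem S A e.
    apply: represents_eq rep _ => b i' j' b12 iN' jN'; rewrite Hm //; last by move: b12; rewrite !inE; lia.
    by rewrite m1 // ifN //; move: b12; rewrite !inE; lia.
  have [_ H] := step mem env rep'.
  by rewrite (H (Ordinal jN)) // -lift1E.
move=> s2 [sr2 m2]; have rdy2 := ready_same_regs sr2 rdy1.
apply: runs_weaken (runs_seq (b' := tab_cost 2 (copy 4) N) (runs_tab (val := val3) rdy2 _) _) _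
  (fun s x => x); last by lia.
  move=> mem env i j iN jN E0 E1 Hm; rewrite (ev_copy _ _ _ iN jN) //.
  by rewrite Hm // m2 //= m1.
move=> s3 [sr3 m3]; have rdy3 := ready_same_regs sr3 rdy2.
apply: runs_weaken (runs_tab (val := val4) rdy3 _) (leqnn _) _.
  move=> mem env i j iN jN E0 E1 Hm; rewrite (ev_copy _ _ _ iN jN) //.
  by rewrite Hm // m3 //= m2.
move=> s4 [sr4 m4]; split.
  exact: same_regs_trans (same_regs_trans (same_regs_trans sr1 sr2) sr3) sr4.
move=> i j; have jN := ltn_ord j; have iN := ltn_ord i; rewrite !m4 //= !m3 //=.
by rewrite /val4 lift1E lift2E lift1E; split; rewrite eqb0 negbK.
Qed.

(** * The kernel *)

Lemma nth_allpairs_row (T1 T2 R : Type) (f : T1 -> T2 -> R) (s : seq T1) (t : seq T2)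
    x0 y0 z0 i j : i < size s -> j < size t ->
  nth z0 [seq f x y | x <- s, y <- t] (i * size t + j) = f (nth x0 s i) (nth y0 t j).
Proof.
elim: s i => [|x s IH] [|i] //= lti ltj; rewrite nth_cat size_map.
  by rewrite mul0n add0n ltj (nth_map y0).
have -> : (i.+1 * size t + j < size t) = false by rewrite mulSn; lia.
by rewrite -IH //; congr nth; rewrite mulSn; lia.
Qed.

Section EncodeCells.
Variable I : instance.
Local Notation N := (nvert I).

Lemma size_encode : size (encode I) = 2 + N + N * N.
Proof.
by rewrite /encode /= size_cat size_map size_allpairs size_enum_ord; lia.
Qed.

Lemma encode_terminal (j : 'I_N) : nth 0 (encode I) (addr N 0 0 j) = (j \in terminals I).
Proof.
have -> : addr N 0 0 j = j.+2 by rewrite /addr; lia.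
rewrite /= nth_cat size_map size_enum_ord ltn_ord.
by rewrite (nth_map j) ?size_enum_ord // nth_ord_enum.
Qed.

Lemma encode_arc (i j : 'I_N) : nth 0 (encode I) (addr N 0 i.+1 j) = Defs.arc i j.
Proof.
have -> : addr N 0 i.+1 j = (N + (i * N + j)).+2 by rewrite /addr; lia.
rewrite /= nth_cat size_map size_enum_ord ifN; last by lia.
have -> : N + (i * N + j) - N = i * size (enum 'I_N) + j by rewrite size_enum_ord; lia.
by rewrite (nth_allpairs_row _ i j) ?size_enum_ord // !nth_ord_enum.
Qed.

(** Every number of the encoding, even 0, counts at least one bit. *)
Lemma input_size_gt : N < input_size I.
Proof.
rewrite /input_size; apply: (@leq_trans (\sum_(x <- encode I) 1)); last exact: leq_sum.
by rewrite sum1_size size_encode; lia.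
Qed.

End EncodeCells.

(** * A fixed no-instance *)

Section NoInstance.

Definition triangle_arc : rel 'I_3 := fun i j => j == i.+1 %% 3 :> nat.

Lemma triangle_tournament : tournament triangle_arc.
Proof.
split=> [[[|[|[|i]]] lti]|[[|[|[|i]]] lti] [[|[|[|j]]] ltj]] //.
Qed.

(** Budget 0 makes it admissible as an output for every input budget. *)
Definition no_instance : instance := Instance triangle_tournament setT 0.

Lemma no_instanceP : ~ yes_instance no_instance.
Proof.
rewrite yes_solvable => -[h sep]; rewrite leqn0 cards_eq0 => /eqP B0.
have mono i j : triangle_arc i j -> h i <= h j.
  move=> eij; rewrite leqNgt; apply/negP => lt.
  have : (i, j) \in back_arcs setT triangle_arc h by rewrite !inE /= eij.
  by rewrite B0 inE.
pose o i (lt : i < 3) := Ordinal lt.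
have h1 := mono (@o 0 isT) (@o 1 isT) isT; have h2 := mono (@o 1 isT) (@o 2 isT) isT.
have h3 := mono (@o 2 isT) (@o 0 isT) isT.
have := sep (@o 0 isT) (@o 1 isT); rewrite !inE => /(_ isT isT isT isT).
by move: h1 h2 h3; clear; lia.
Qed.

Lemma encode_no_instance :
  encode no_instance = [:: 3; 0; 1; 1; 1; 0; 1; 0; 0; 0; 1; 1; 0; 0].
Proof.
have E : enum 'I_3 = [:: inord 0; inord 1; inord 2].
  by apply: (inj_map val_inj); rewrite val_enum_ord /= !inordK.
by rewrite /encode [nvert _]/= E /= !inE /triangle_arc !inordK.
Qed.

End NoInstance.

Definition emit_list (l : seq nat) : prog := foldr (fun c p => Seq (emit (Cst c)) p) Skip l.

Lemma runs_emit_list N k l w s : ready N k s -> written w s ->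
  size w + size l <= out_base N ->
  runs (emit_list l) s (13 * size l + 1) (fun s' => written (w ++ l) s').
Proof.
elim: l w s => [|c l IH] w s rdy wr le /=; first by apply: runs_skip; rewrite cats0.
apply: runs_weaken (runs_seq (b' := 13 * size l + 1) (runs_emit (v := c) rdy wr _ _) _)
  _ (fun s x => x) => //=.
- by move: le => /=; lia.
- move=> s1 [rdy1 wr1 _ _ _]; rewrite -cat_rcons; apply: IH => //.
  by rewrite size_rcons; move: le => /=; lia.
- by lia.
Qed.

(** * Size test and output of the kernel *)

Definition eCount := Count 1 (eAlive 1).
Definition eDouble (n : nat) : ex := iter n (Let 2 (Plus (Var 2) (Var 2))) (Var 2).
(** The product [k * k] is out of reach of a sum over [N] indices when [k > N]; what is computed is
    [128 * (minn N k * k + 1)]. For [k > N] this exceeds [N], so the outcome of the test is right in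
    either case. *)
Definition eBound := Let 2 (Plus (Sum 1 (Ite (Lt (Var 1) Par) Par (Cst 0))) (Cst 1)) (eDouble 7).
Definition eTooBig := Lt eBound eCount.
(** [emit_all] always scans pairs; fixing [Var 0] to 0 turns it into a single scan for the
    terminals. *)
Definition eCond1 := And (Eqv (Var 0) (Cst 0)) (eAlive 1).
Definition eCond2 := And (eAlive 0) (eAlive 1).
Definition eVal1 := Bool (eTer 1).
Definition eVal2 := Bool (eArc 0 1).

Lemma ev_double N k mem env n : ev N k mem env (eDouble n) = 2 ^ n * env 2.
Proof.
elim: n env => [|n IH] env; first by rewrite mul1n.
rewrite -[LHS]/(ev N k mem (update env 2 (env 2 + env 2)) (eDouble n)) IH upd_eq expnS.
lia.
Qed.

Lemma ev_bound N k mem env : ev N k mem env eBound = 128 * (minn N k * k + 1).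
Proof.
rewrite /eBound -[LHS]/(ev N k mem (update env 2 (ev N k mem env
  (Sum 1 (Ite (Lt (Var 1) Par) Par (Cst 0))) + 1)) (eDouble 7)) ev_double upd_eq.
congr (_ * (_ + 1)); rewrite /= /update /=.
elim: N => [|N IH]; first by rewrite big_ord0 min0n.
rewrite big_ord_recr /= IH.
case: (ltnP N k) => h; last first.
  have -> : (k - N == 0) = true by lia.
  by rewrite addn0; congr (_ * _); lia.
have -> : (k - N == 0) = false by lia.
by rewrite !(minn_idPl _) ?(ltnW h) // mulSn addnC.
Qed.

Lemma enum_setE N (A : {set 'I_N}) : enum A = [seq x <- enum 'I_N | x \in A].
Proof. by rewrite {1}/enum_mem -enumT. Qed.

Lemma emitted_row N (A : {set 'I_N}) (v : nat -> nat -> nat)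
    (cnd : nat -> nat -> bool) i (f : 'I_N -> nat) :
  (forall j : 'I_N, cnd i j = (j \in A)) -> (forall j : 'I_N, v i j = f j) ->
  emitted N cnd v i = [seq f x | x <- enum A].
Proof.
move=> Hc Hv; rewrite /emitted -val_enum_ord filter_map -map_comp enum_setE.
have -> : [seq x <- enum 'I_N | preim val (cnd i) x] = [seq x <- enum 'I_N | x \in A].
  by apply: eq_filter => x; rewrite /= Hc.
by apply: eq_map => x; rewrite /= Hv.
Qed.

Lemma emitted_nil N cnd val i : (forall j, j < N -> cnd i j = false) ->
  emitted N cnd val i = [::].
Proof.
move=> H; rewrite /emitted (eq_in_filter (a2 := pred0)) ?filter_pred0 // => j.
by rewrite mem_iota => /andP[_ /H].
Qed.

Definition yes_prog : prog :=
  Seq (emit eCount) (Seq (emit Par) (Seq (emit_all eCond1 eVal1) (emit_all eCond2 eVal2))).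

Definition yes_cost n : nat :=
  comp_cost eCount n + emit_all_cost eCond1 eVal1 n + emit_all_cost eCond2 eVal2 n + 40.

Lemma runs_yes N k (S A : {set 'I_N}) (e : rel 'I_N) s (tour : tournament_on A e) :
  ready N k s -> regs s 6 = 0 -> represents (memory s) S A e ->
  runs yes_prog s (yes_cost N) (fun s' => holds_output s' (encode (induced S k tour))).
Proof.
move=> rdy E6 rep; rewrite encode_induced.
have repE mem : (forall z, out_base N <= z -> mem z = memory s z) -> represents mem S A e.
  move=> H; apply: represents_eq rep _ => b i j b12 _ _; apply: H; apply: out_base_le.
  by move: b12; rewrite !inE; lia.
have cA : #|A| <= N by rewrite -[X in _ <= X]card_ord max_card.
have base : out_base N = 2 + N + N * N by rewrite /out_base /addr; lia.
have wr0 : written [::] s by [].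
have evc : ev N k (memory s) (env_of s) eCount = #|A|.
  by apply: card_count => j; apply: tr_alive.
apply: runs_weaken (runs_seq (b' := emit_all_cost eCond1 eVal1 N +
  emit_all_cost eCond2 eVal2 N + 25) (runs_emit rdy wr0 _ evc) _) _ (fun s x => x);
  rewrite ?base //; last by rewrite /yes_cost; lia.
move=> s1 [rdy1 wr1 sa1 _ _].
have evk : ev N k (memory s1) (env_of s1) Par = k by [].
apply: runs_weaken (runs_seq (b' := emit_all_cost eCond1 eVal1 N +
  emit_all_cost eCond2 eVal2 N + 1) (runs_emit rdy1 wr1 _ evk) _) _ (fun s x => x);
  rewrite ?base //=; last by lia.
move=> s2 [rdy2 wr2 sa2 _ _].
have sa02 mem : (forall z, out_base N <= z -> mem z = memory s2 z) -> represents mem S A e.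
  by move=> H; apply: repE => z zl; rewrite H // sa2 // sa1.
pose cnd1 i j := (i == 0) && lift1 A j; pose val1 (i j : nat) : nat := lift1 S j.
pose cnd2 i j := lift1 A i && lift1 A j; pose val2 (i j : nat) : nat := lift2 e i j.
have out1 : flatten [seq emitted N cnd1 val1 i | i <- iota 0 N] =
    [seq nat_of_bool (x \in S) | x <- enum A].
  have row : emitted N cnd1 val1 0 = [seq nat_of_bool (x \in S) | x <- enum A].
    by apply: emitted_row => j; rewrite /cnd1 /val1 lift1E.
  rewrite -row; case: (N) => [|n]; first by [].
  rewrite /= -[RHS]cats0; congr (_ ++ _).
  have : {in iota 1 n, emitted n.+1 cnd1 val1 =1 fun=> [::]}.
    move=> i; rewrite mem_iota => /andP[i1 _]; apply: emitted_nil => j _.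
    by rewrite /cnd1 gtn_eqF.
  by move/eq_in_map => ->; elim: (iota 1 n).
have out2 : flatten [seq emitted N cnd2 val2 i | i <- iota 0 N] =
    [seq nat_of_bool (e x y) | x <- enum A, y <- enum A].
  rewrite -val_enum_ord.
  have key (l : seq 'I_N) : flatten [seq emitted N cnd2 val2 i | i <- map val l] =
      [seq nat_of_bool (e x y) | x <- [seq x <- l | x \in A], y <- enum A].
    elim: l => //= x l ->; case xA: (x \in A) => /=.
      congr (_ ++ _); apply: emitted_row => j.
        by rewrite /cnd2 !lift1E xA.
      by rewrite /val2 lift2E.
    by rewrite emitted_nil // => j _; rewrite /cnd2 lift1E xA.
  by rewrite key -enum_setE.
have sz1 : size [seq nat_of_bool (x \in S) | x <- enum A] = #|A| by rewrite size_map -cardE.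
have sz2 : size [seq nat_of_bool (e x y) | x <- enum A, y <- enum A] = #|A| * #|A|.
  by rewrite size_allpairs -!cardE.
have sq : #|A| * #|A| <= N * N by apply: leq_mul.
apply: runs_weaken (runs_seq (runs_emit_all (cnd := cnd1) (val := val1) rdy2 wr2 _ _) _) _
  (fun s x => x); [| |move=> s3 [rdy3 sa3 wr3]|].
- move=> mem env i j lti ltj E0 E1 Hm; have rep' := sa02 _ Hm; split.
    apply: tr_and; first exact: tr_eqv.
    rewrite -[j]/(nat_of_ord (Ordinal ltj)) lift1E; exact: tr_alive.
  rewrite /val1 -[j]/(nat_of_ord (Ordinal ltj)) lift1E; apply: ev_bool; exact: tr_ter.
- by rewrite out1 sz1 /= base -addnA leq_add2l (leq_trans cA) ?leq_addr.
- rewrite out1 in wr3; apply: runs_weaken (runs_emit_all (cnd := cnd2) (val := val2) rdy3 wr3 _ _)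
    (leqnn _) _.
  + move=> mem env i j lti ltj E0 E1 Hm.
    have rep' : represents mem S A e by apply: sa02 => z zl; rewrite Hm // sa3.
    rewrite -[i]/(nat_of_ord (Ordinal lti)) -[j]/(nat_of_ord (Ordinal ltj)).
    rewrite /cnd2 /val2 lift2E !lift1E; split; first by apply: tr_and; apply: tr_alive.
    by apply: ev_bool; apply: tr_arc.
  + by rewrite out2 size_cat sz1 sz2 /= base leq_add ?leq_add.
  move=> s4 [_ _ [_ Hw]]; rewrite out2 -catA /= in Hw; exact: Hw.
- by lia.
Qed.

Definition no_list : seq nat := [:: 3; 0; 1; 1; 1; 0; 1; 0; 0; 0; 1; 1; 0; 0].

Definition main_prog : prog :=
  Seq init_prog (Seq (tab 1 (copy 0)) (Seq (tab 2 (Cst 1))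
 (Seq (for_loop 5 (Reg 0) body)
 (Seq (comp 0 eTooBig) (If (Reg (treg 0)) (emit_list no_list) yes_prog))))).

Definition main_cost n : nat :=
  20 * n + 40 + tab_cost 1 (copy 0) n + tab_cost 2 (Cst 1) n + for_cost 1 (body_cost n) n +
  comp_cost eTooBig n + yes_cost n + 300.

Lemma poly_bounded_main_cost : poly_bounded main_cost.
Proof.
have H1 := poly_bounded_tab_cost; have H2 := poly_bounded_comp_cost.
have H3 := poly_bounded_emit_all_cost.
have H4 : poly_bounded body_cost.
  by rewrite /body_cost; repeat first [exact: H1 | exact: poly_bounded_const
    | apply: poly_bounded_add].
have H5 : poly_bounded yes_cost.
  by rewrite /yes_cost; repeat first [exact: H2 | exact: H3 | exact: poly_bounded_const
    | apply: poly_bounded_add].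
have H6 : poly_bounded (fun n => for_cost 1 (body_cost n) n).
  by rewrite /for_cost; poly_bounded_tac.
rewrite /main_cost.
repeat first [exact: H1 | exact: H2 | exact: H5 | exact: H6 | exact: poly_bounded_const
  | exact: poly_bounded_id | apply: poly_bounded_add | apply: poly_bounded_mul].
Qed.

Definition kernel_of (I I' : instance) : Prop :=
  [/\ yes_instance I <-> yes_instance I', nvert I' <= 128 * (budget I ^ 2 + 1) &
      budget I' <= budget I].

Lemma runs_main I : runs main_prog (init_state (encode I)) (main_cost (nvert I))
  (fun s => exists2 I', kernel_of I I' & holds_output s (encode I')).
Proof.
set N := nvert I; set k := budget I; set S := terminals I; set s0 := init_state _.
have tourT : tournament_on setT (@Defs.arc I).
  case: (arc_tournament I) => irr tot; split=> [x _|x y _ _ xy]; first by rewrite irr.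
  by have := tot _ _ xy; case: (Defs.arc x y); case: (Defs.arc y x).
apply: runs_weaken (runs_seq (b' := main_cost N - (20 * N + 41))
  (@runs_init N k s0 _ _ _) _) _ (fun s x => x); rewrite // ?/main_cost; try lia.
move=> s1 [rdy1 m1 E1].
apply: runs_weaken (runs_seq (b' := tab_cost 2 (Cst 1) N + for_cost 1 (body_cost N) N +
  comp_cost eTooBig N + yes_cost N + 290)
  (runs_tab (val := fun i j => memory s1 (addr N 0 i j)) rdy1 _) _) _ (fun s x => x);
  try lia.
  by move=> mem env i j iN jN F0 F1 Hm; rewrite (ev_copy _ _ _ iN jN) // Hm.
move=> s2 [sr2 m2]; have rdy2 := ready_same_regs sr2 rdy1.
apply: runs_weaken (runs_seq (b' := for_cost 1 (body_cost N) N +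
  comp_cost eTooBig N + yes_cost N + 285)
  (runs_tab (val := fun=> fun=> 1) rdy2 _) _) _ (fun s x => x); rewrite //; try lia.
move=> s3 [sr3 m3]; have rdy3 := ready_same_regs sr3 rdy2.
have rep3 : represents (memory s3) S setT (@Defs.arc I).
  move=> i j; have jN := ltn_ord j; have iN := ltn_ord i.
  rewrite !m3 //= !m2 //= m1 inE; split=> //.
    by rewrite -[memory s0 _]/(nth 0 (encode I) _) encode_terminal eqb0 negbK.
  by rewrite -[memory s0 _]/(nth 0 (encode I) _) encode_arc eqb0 negbK.
have E3 : regs s3 6 = 0 by rewrite sr3 // sr2.
(* Until irreducibility is reached each round deletes a vertex. After [N] rounds the instance is
   irreducible, if only because no vertex is left. *)
pose Inv i s := [/\ ready N k s, regs s 6 = 0, regs s 5 = i & exists A e,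
  [/\ represents (memory s) S A e, tournament_on A e,
      yes_instance I <-> solvable S A e k & irreducible k S A e || (#|A| + i <= N)]].
apply: runs_weaken (runs_seq (b' := comp_cost eTooBig N + yes_cost N + 280)
  (runs_for (Inv := Inv) (n := N) (b := body_cost N) _ _ _) _) _ (fun s x => x).
- split; [exact: ready_update|by []|by []|].
  exists setT, (@Defs.arc I); split=> //; first exact: yes_solvable.
  by rewrite cardsT card_ord addn0 leqnn orbT.
- by move=> i s [[E0 _ _] _ E5 _].
- move=> i s lti [rdy E6 E5 [A [e [rep tour iff prog]]]].
  have [A' [e' step]] := step_exists k S tour.
  apply: runs_weaken (runs_body rdy rep step) (leqnn _) _ => s' [sr rep'].
  have [tour' iff' prog' _] := step; split=> /=.
  + apply: ready_update => //; exact: ready_same_regs rdy.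
  + by rewrite /update /= sr.
  + by rewrite /update eqxx sr // E5.
  exists A', e'; split=> //; first by rewrite iff.
  move: prog'; case: ifP prog => [irr _ [-> ->]|_ /= le lt]; first by rewrite irr.
  by apply/orP; right; move: le lt; lia.
- move=> s4 [rdy4 E4 _ [A [e [rep tour iff prog]]]].
  have irr : irreducible k S A e.
    case/orP: prog => // le; have /eqP : #|A| == 0 by lia.
    move/eqP; rewrite cards_eq0 => /eqP A0; apply/andP; split; apply/forallP => i.
      by rewrite /class_rule_at A0 inE.
    by rewrite /module_rule_at A0 inE /= andbF.
  apply: runs_weaken (runs_seq (b' := yes_cost N + 250) (runs_comp eTooBig 0 rdy4) _) _
    (fun s x => x); last by lia.
  move=> s5 [m5 v5 k5]; have rdy5 := ready_keep rdy4 k5.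
  have E5 : regs s5 6 = 0 by rewrite k5.
  have cA : #|A| <= N by rewrite -[X in _ <= X]card_ord max_card.
  have Ebig : (regs s5 (treg 0) != 0) = (128 * (minn N k * k + 1) < #|A|).
    rewrite v5; apply: tr_lt; first exact: ev_bound.
    by apply: card_count => j; apply: tr_alive.
  apply: runs_weaken (runs_if (b := 200) (b' := yes_cost N) _ _) _ (fun s x => x) => /=.
  + rewrite Ebig => big.
    (* The fixed output fits below the arrays, because failing the size test forces [N] above
       128. *)
    apply: runs_weaken (runs_emit_list (w := [::]) (l := no_list) rdy5 _ _) _ _ => //.
      by rewrite /out_base /addr /=; move: big cA; lia.
    move=> s6 [_ out6]; exists no_instance; last by move=> i; rewrite encode_no_instance; apply: out6.
    split=> //; last by rewrite /=; lia.
    split=> [|/no_instanceP //]; rewrite iff => sol.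
    have := irreducible_card tour irr sol; rewrite leqNgt => /negP; case.
    apply: (leq_ltn_trans _ big); rewrite leq_mul2l /= leq_add2r expnS expn1.
    case: (leqP k N) => [//|lt].
    have : N <= N * k by rewrite leq_pmulr // (leq_ltn_trans _ lt).
    move: big cA; rewrite (minn_idPl (ltnW lt)).
    by move: #|A| (N * k) => a b; clear; lia.
  + move=> /eqP; rewrite -[_ == 0]negbK Ebig -leqNgt => small.
    have rep5 : represents (memory s5) S A e by rewrite m5.
    apply: runs_weaken (runs_yes tour rdy5 E5 rep5) (leqnn _) _ => s6 out6.
    exists (induced S k tour) => //; split=> //; first by rewrite yes_induced.
    apply: leq_trans small _; rewrite leq_mul2l /= leq_add2r expnS expn1 leq_mul2r.
    by rewrite geq_minr orbT.
  + lia.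
- by rewrite /for_cost /=; lia.
Qed.

Theorem theorem1 :
  exists kernel : instance -> instance,
    poly_time kernel /\
    exists C : nat, forall I : instance,
      [/\ yes_instance I <-> yes_instance (kernel I),
          nvert (kernel I) <= C * (budget I ^ 2 + 1) &
          budget (kernel I) <= budget I].
Proof.
have ex I : exists I', kernel_of I I' /\
    runs main_prog (init_state (encode I)) (main_cost (nvert I))
         (fun s => holds_output s (encode I')).
  have [t [s [run le [I' ker out]]]] := runs_main I.
  by exists I'; split=> //; exists t, s.
(* The steps were only shown to exist, so the output instance is known only existentially for each
   input; choice collects these instances into a function, which the one program [main_prog]
   computes. *)
have [kernel Hk] := functional_choice _ ex.
exists kernel; split; last by exists 128 => I; case: (Hk I).
have [c [d Hc]] := poly_bounded_main_cost.
exists main_prog, c, d => I; have [_ [t [s [run le out]]]] := Hk I.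
exists t, s; split=> //; apply: leq_trans le _; apply: leq_trans (Hc _) _.
(* The bases compare by [N + 1 <= input_size I]; exponent 0 is split off because [leq_exp2r] needs a
   positive one. *)
rewrite leq_mul2l; apply/orP; right; case: d {Hc} => // d.
by rewrite leq_exp2r // input_size_gt.
Qed.
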